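(* Let $L$ be the set of all formulas $\phi$ of the logic of graph modifiers in which neither a local assignment $\omega:=_l\chi$ nor the iteration operator ${}^\star$ occurs and such that $\mathcal{C}_{all}\models\phi$ (i.e. $\phi$ is true in all rooted termgraphs). Then membership in $L$ is decidable.
   Context: **Syntax.** Let $\mathcal{F}$ (edge labels $a,b,\dots$) and $\Omega$ (node labels $\omega,\pi,\dots$) be countable sets (effectively enumerated, so that formulas are finite objects that can be input to an algorithm). Actions $\alpha,\beta$ and formulas $\phi,\psi$ are defined by mutual recursion: $\alpha ::= a \mid U \mid n \mid \vec{n} \mid \phi? \mid (\omega:=_g\phi) \mid (\omega:=_l\phi) \mid (a+(\phi,\psi)) \mid (a-(\phi,\psi)) \mid (\alpha;\beta) \mid (\alpha\cup\beta) \mid \alpha^\star$, $\phi ::= \omega \mid \bot \mid \neg\phi \mid (\phi\vee\psi) \mid [\alpha]\phi$, with $a\in\mathcal{F}$, $\omega\in\Omega$. Other Boolean connectives are abbreviations, and $\langle\alpha\rangle\phi:=\neg[\alpha]\neg\phi$. ''Occurs'' refers to occurrence at any depth, including inside formulas that are nested in actions. **Rooted termgraphs.** A rooted termgraph is $G=(\mathcal{N},\mathcal{E},\mathcal{L}^n,\mathcal{L}^e,\mathcal{S},\mathcal{T},n_0)$ with a set of nodes $\mathcal{N}$, a set of edges $\mathcal{E}$, node labelling $\mathcal{L}^n:\mathcal{N}\to\mathcal{P}(\Omega)$, edge labelling $\mathcal{L}^e:\mathcal{E}\to\mathcal{F}$, source and target maps $\mathcal{S},\mathcal{T}:\mathcal{E}\to\mathcal{N}$,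 and root $n_0\in\mathcal{N}$. $\mathcal{C}_{all}$ is the class of all rooted termgraphs. An edge $(m,a,m')$ means an edge labelled $a$ with source $m$ and target $m'$. Write $G_m$ for $G$ with its root replaced by $m$. **Semantics.** $G\models\omega$ iff $\omega\in\mathcal{L}^n(n_0)$; $\bot,\neg,\vee$ as usual; $G\models[\alpha]\phi$ iff $G'\models\phi$ for all rooted termgraphs $G'$ with $G\to_\alpha G'$, where (components not mentioned, including the root, are unchanged): - $G\to_a G'$: only the root changes, to some $n_0'$ such that there is an edge $(n_0,a,n_0')$; - $G\to_U G'$: only the root may change, to an arbitrary node; - $G\to_{\phi?}G'$: $G'=G$ and $G\models\phi$; - $G\to_n G'$: a new node with empty label set and no incident edges is added; - $G\to_{\vec{n}}G'$: as for $n$, and the root becomes the new node; - $G\to_{\omega:=_g\phi}G'$: for every node $m$, the new label set of $m$ is $\mathcal{L}^n(m)\cup\{\omega\}$ if $G_m\models\phi$ and $\mathcal{L}^n(m)\setminus\{\omega\}$ otherwise; - $G\to_{\omega:=_l\phi}G'$: the same, but only for the node $m=n_0$; - $G\to_{a+(\phi,\psi)}G'$: edges $(m,a,m')$ are added for all $m,m'$ with $G_m\models\phi$ and $G_{m'}\models\psi$; - $G\to_{a-(\phi,\psi)}G'$: all edges $(m,a,m')$ with $G_m\models\phi$ and $G_{m'}\models\psi$ are deleted; - $\to_{\alpha;\beta}$ is relational composition (first $\alpha$, then $\beta$), $\to_{\alpha\cup\beta}$ is union, $\to_{\alpha^\star}$ is the reflexive transitive closure of $\to_\alpha$. $\mathcal{C}\models\phi$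 means $G\models\phi$ for every $G\in\mathcal{C}$. *)

(* Defs.v *)
From Stdlib Require Cantor Relation_Operators.
From mathcomp Require Import all_boot.

Set Implicit Arguments.
Unset Strict Implicit.
Unset Printing Implicit Defensive.

(** [NewNode] and [NewRoot] are the actions [n] and [n] with an arrow: both add
    a node, but only the second one moves the root there. *)
Inductive action (F Omega : Type) : Type :=
| Edge (a : F)
| Univ
| NewNode
| NewRoot
| Test (phi : formula F Omega)
| GlobalAssign (w : Omega) (phi : formula F Omega)
| LocalAssign (w : Omega) (phi : formula F Omega)
| AddEdges (a : F) (phi psi : formula F Omega)
| DelEdges (a : F) (phi psi : formula F Omega)
| Seq (alpha beta : action F Omega)
| Choice (alpha beta : action F Omega)
| Star (alpha : action F Omega)
with formula (F Omega : Type) : Type :=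
| Label (w : Omega)
| Bot
| Neg (phi : formula F Omega)
| Or (phi psi : formula F Omega)
| Box (alpha : action F Omega) (phi : formula F Omega).

Arguments Univ {F Omega}.
Arguments NewNode {F Omega}.
Arguments NewRoot {F Omega}.
Arguments Bot {F Omega}.

(** [action_occurs p alpha]: some action satisfying [p] occurs in [alpha], at
    any depth, including inside the formulas nested in actions. *)
Fixpoint action_occurs (F Omega : Type) (p : pred (action F Omega))
    (alpha : action F Omega) {struct alpha} : bool :=
  p alpha ||
  match alpha with
  | Edge _ | Univ | NewNode | NewRoot => false
  | Test phi | GlobalAssign _ phi | LocalAssign _ phi => formula_occurs p phi
  | AddEdges _ phi psi | DelEdges _ phi psi =>
      formula_occurs p phi || formula_occurs p psi
  | Seq beta gamma | Choice beta gamma =>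
      action_occurs p beta || action_occurs p gamma
  | Star beta => action_occurs p beta
  end
with formula_occurs (F Omega : Type) (p : pred (action F Omega))
    (phi : formula F Omega) {struct phi} : bool :=
  match phi with
  | Label _ | Bot => false
  | Neg psi => formula_occurs p psi
  | Or psi chi => formula_occurs p psi || formula_occurs p chi
  | Box alpha psi => action_occurs p alpha || formula_occurs p psi
  end.

Definition is_local_assign (F Omega : Type) (alpha : action F Omega) : bool :=
  if alpha is LocalAssign _ _ then true else false.

Definition is_star (F Omega : Type) (alpha : action F Omega) : bool :=
  if alpha is Star _ then true else false.

Record termgraph (F Omega : Type) : Type := Termgraph {
  node : Type;
  edge : Type;
  nlabel : node -> Omega -> Prop;
  elabel : edge -> F;
  source : edge -> node;
  target : edge -> node;
  root : node
}.

Arguments nlabel {F Omega} t m w.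
Arguments elabel {F Omega} t e.
Arguments source {F Omega} t e.
Arguments target {F Omega} t e.
Arguments root {F Omega} t.

Definition reroot (F Omega : Type) (G : termgraph F Omega) (m : node G) :
    termgraph F Omega :=
  Termgraph (nlabel G) (elabel G) (source G) (target G) m.

Definition relabel (F Omega : Type) (G : termgraph F Omega)
    (L : node G -> Omega -> Prop) : termgraph F Omega :=
  Termgraph L (elabel G) (source G) (target G) (root G).

(** The fresh node is [None : option (node G)]. *)
Definition add_node (F Omega : Type) (G : termgraph F Omega) :
    termgraph F Omega :=
  @Termgraph F Omega (option (node G)) (edge G)
    (fun m w => if m is Some m' then nlabel G m' w else False)
    (elabel G)
    (fun e => Some (source G e)) (fun e => Some (target G e))
    (Some (root G)).

(** One new [a]-edge for each pair of nodes in [A] x [B]. *)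
Definition add_edges (F Omega : Type) (G : termgraph F Omega) (a : F)
    (A B : node G -> Prop) : termgraph F Omega :=
  @Termgraph F Omega
    (node G) (edge G + {mm : node G * node G | A mm.1 /\ B mm.2})%type
    (nlabel G)
    (fun e => match e with inl e => elabel G e | inr _ => a end)
    (fun e => match e with inl e => source G e | inr mm => (sval mm).1 end)
    (fun e => match e with inl e => target G e | inr mm => (sval mm).2 end)
    (root G).

Definition del_edges (F Omega : Type) (G : termgraph F Omega) (a : F)
    (A B : node G -> Prop) : termgraph F Omega :=
  @Termgraph F Omega
    (node G)
    {e : edge G | ~ [/\ elabel G e = a, A (source G e) & B (target G e)]}
    (nlabel G)
    (fun e => elabel G (sval e))
    (fun e => source G (sval e))
    (fun e => target G (sval e))
    (root G).

(** [L] with [w] added if [P] holds, and with [w] removed otherwise. *)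
Definition assign (Omega : Type) (w : Omega) (P : Prop) (L : Omega -> Prop) :
    Omega -> Prop :=
  fun w' => (P /\ (L w' \/ w' = w)) \/ (~ P /\ (L w' /\ w' <> w)).

Fixpoint sat (F Omega : Type) (phi : formula F Omega) (G : termgraph F Omega)
    {struct phi} : Prop :=
  match phi with
  | Label w => nlabel G (root G) w
  | Bot => False
  | Neg psi => ~ sat psi G
  | Or psi chi => sat psi G \/ sat chi G
  | Box alpha psi => forall G', step alpha G G' -> sat psi G'
  end
with step (F Omega : Type) (alpha : action F Omega)
    (G G' : termgraph F Omega) {struct alpha} : Prop :=
  match alpha with
  | Edge a => exists e : edge G,
      [/\ source G e = root G, elabel G e = a & G' = reroot (target G e)]
  | Univ => exists m : node G, G' = reroot m
  | NewNode => G' = add_node G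
  | NewRoot => G' = @reroot F Omega (add_node G) None
  | Test phi => G' = G /\ sat phi G
  | GlobalAssign w phi =>
      G' = relabel (fun m => assign w (sat phi (reroot m)) (nlabel G m))
  | LocalAssign w phi =>
      G' = relabel (fun m w' =>
             (m = root G /\ assign w (sat phi (reroot m)) (nlabel G m) w') \/
             (m <> root G /\ nlabel G m w'))
  | AddEdges a phi psi =>
      G' = add_edges a (fun m : node G => sat phi (reroot m))
                       (fun m : node G => sat psi (reroot m))
  | DelEdges a phi psi =>
      G' = del_edges a (fun m : node G => sat phi (reroot m))
                       (fun m : node G => sat psi (reroot m))
  | Seq beta gamma => exists H, step beta G H /\ step gamma H G'
  | Choice beta gamma => step beta G G' \/ step gamma G G'
  | Star beta =>
      Relation_Operators.clos_refl_trans (termgraph F Omega) (step beta) G G'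
  end.

Definition valid_in (F Omega : Type) (C : termgraph F Omega -> Prop)
    (phi : formula F Omega) : Prop :=
  forall G, C G -> sat phi G.

Definition all_termgraphs (F Omega : Type) : termgraph F Omega -> Prop :=
  fun _ => True.

Inductive recfun : nat -> Type :=
| RZero k : recfun k
| RSucc : recfun 1
| RProj k (i : 'I_k) : recfun k
| RComp k m (f : recfun m) (g : 'I_m -> recfun k) : recfun k
| RPrec k (f : recfun k) (g : recfun k.+2) : recfun k.+1
| RMin k (f : recfun k.+1) : recfun k.

(** [reval f v y]: the function coded by [f] is defined at [v], with value [y].
    In a primitive recursion, [h (0, v) = f v] and
    [h (n.+1, v) = g (n, h (n, v), v)]; [RMin f] maps [v] to the least [y] with
    [f (y, v) = 0], provided that [f (z, v)] is defined for all [z < y]. *)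
Fixpoint reval (k : nat) (f : recfun k) {struct f} :
    k.-tuple nat -> nat -> Prop :=
  match f in recfun k return k.-tuple nat -> nat -> Prop with
  | RZero _ => fun _ y => y = 0
  | RSucc => fun v y => y = (thead v).+1
  | RProj _ i => fun v y => y = tnth v i
  | RComp _ m f g => fun v y =>
      exists u : m.-tuple nat,
        (forall i, reval (g i) v (tnth u i)) /\ reval f u y
  | RPrec _ f g => fun v =>
      (fix prec (n : nat) (y : nat) : Prop :=
         match n with
         | 0 => reval f [tuple of behead v] y
         | n'.+1 => exists z : nat,
             prec n' z /\ reval g [tuple of n' :: z :: behead v] y
         end) (thead v)
  | RMin _ f => fun v y =>
      reval f [tuple of y :: v] 0 /\
      (forall z, z < y -> exists t : nat, reval f [tuple of z :: v] t.+1)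
  end.

(** The set [L] of objects of [T] is decidable, objects being given to the
    algorithm through their numbers [code x]: its characteristic function is
    computed by a recursive function. *)
Definition decidable_set (T : Type) (code : T -> nat) (L : T -> Prop) : Prop :=
  exists f : recfun 1, forall x : T,
    (L x -> reval f [tuple code x] 1) /\ (~ L x -> reval f [tuple code x] 0).

(** Goedel numbers of actions and formulas: a tag paired with the numbers of
    the immediate constituents, with [pickle] enumerating the labels. *)
Fixpoint action_code (F Omega : countType) (alpha : action F Omega) : nat :=
  match alpha with
  | Edge a => Cantor.to_nat (1, pickle a)
  | Univ => Cantor.to_nat (2, 0)
  | NewNode => Cantor.to_nat (3, 0)
  | NewRoot => Cantor.to_nat (4, 0)
  | Test phi => Cantor.to_nat (5, formula_code phi)
  | GlobalAssign w phi =>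
      Cantor.to_nat (6, Cantor.to_nat (pickle w, formula_code phi))
  | LocalAssign w phi =>
      Cantor.to_nat (7, Cantor.to_nat (pickle w, formula_code phi))
  | AddEdges a phi psi =>
      Cantor.to_nat (8, Cantor.to_nat (pickle a,
        Cantor.to_nat (formula_code phi, formula_code psi)))
  | DelEdges a phi psi =>
      Cantor.to_nat (9, Cantor.to_nat (pickle a,
        Cantor.to_nat (formula_code phi, formula_code psi)))
  | Seq beta gamma =>
      Cantor.to_nat (10, Cantor.to_nat (action_code beta, action_code gamma))
  | Choice beta gamma =>
      Cantor.to_nat (11, Cantor.to_nat (action_code beta, action_code gamma))
  | Star beta => Cantor.to_nat (12, action_code beta)
  end
with formula_code (F Omega : countType) (phi : formula F Omega) : nat :=
  match phi with
  | Label w => Cantor.to_nat (1, pickle w)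
  | Bot => Cantor.to_nat (2, 0)
  | Neg psi => Cantor.to_nat (3, formula_code psi)
  | Or psi chi =>
      Cantor.to_nat (4, Cantor.to_nat (formula_code psi, formula_code chi))
  | Box alpha psi =>
      Cantor.to_nat (5, Cantor.to_nat (action_code alpha, formula_code psi))
  end.

(* Main.v *)
From Stdlib Require Cantor.
From Stdlib Require Import Classical FunctionalExtensionality PropExtensionality.
From mathcomp Require Import all_boot zify.
Require Import Defs.

(** Without local assignment and iteration, reduction axioms push every graph
    modifier through the Booleans and modalities, so each formula is equivalent
    to a static one, built from labels, Booleans, the edge modalities and the
    universal modality. By filtration, a static formula with code [y] is valid
    iff it belongs to every member of every coherent set of types, a type being
    a set of numbers at most [y]; this is a condition with bounded quantifiers.

    The graph of the translation is given by finitely many Horn clauses over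
    pairs of numbers. To compute the translation of [phi] one searches for a
    finite table of facts, coded by the bits of a number, that contains a fact
    about [phi] and in which every fact is the conclusion of a clause with its
    premises in the table: soundness holds by induction on formulas, although
    the table itself may be circular. Local assignments and iterations are
    translated arbitrarily, but counted by a flag. Only one unbounded search is
    needed, over a common bound for the table and the witnesses. *)

Set Implicit Arguments.
Unset Strict Implicit.
Unset Printing Implicit Defensive.

(** * A language of bounded arithmetic compiled to recursive functions *)

Lemma reval_comp k m (f : recfun m) (g : 'I_m -> recfun k) v (u : 'I_m -> nat) y :
  (forall i, reval (g i) v (u i)) -> reval f [tuple u i | i < m] y ->
  reval (RComp f g) v y.
Proof. by move=> gu fy; exists [tuple u i | i < m]; split=> // i; rewrite tnth_mktuple. Qed.

Lemma reval_val k (f : recfun k) (u v : k.-tuple nat) y :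
  reval f u y -> val u = val v -> reval f v y.
Proof. by move=> fu /val_inj<-. Qed.

Lemma reval_prec k (f : recfun k) (g : recfun k.+2) (v : k.-tuple nat) (h : nat -> nat) :
  reval f v (h 0) ->
  (forall n, reval g [tuple of [:: n, h n & v]] (h n.+1)) ->
  forall u : k.+1.-tuple nat, behead u = v ->
  reval (RPrec f g) u (h (thead u)).
Proof.
move=> f0 gS u tl_u /=; elim: (thead u) => [|n IHn]; first exact: (reval_val f0).
by exists (h n); split=> //; apply: (reval_val (gS n)); rewrite /= tl_u.
Qed.

Definition rcomp1 k (f : recfun 1) (g : recfun k) : recfun k := RComp f (fun=> g).

Definition rcomp2 k (f : recfun 2) (g h : recfun k) : recfun k :=
  RComp f (fun i : 'I_2 => if val i == 0 then g else h).

Lemma reval_comp1 k (f : recfun 1) (g : recfun k) v x y :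
  reval g v x -> reval f [tuple x] y -> reval (rcomp1 f g) v y.
Proof. by move=> gx fy; exists [tuple x]; split=> // i; rewrite (tnth_nth 0) ord1. Qed.

Lemma reval_comp2 k (f : recfun 2) (g h : recfun k) v x1 x2 y :
  reval g v x1 -> reval h v x2 -> reval f [tuple x1; x2] y ->
  reval (rcomp2 f g h) v y.
Proof.
move=> gx hx fy; exists [tuple x1; x2]; split=> // -[[|[|//]] lti] /=;
by rewrite (tnth_nth 0).
Qed.

Fixpoint rconst k (n : nat) : recfun k :=
  if n is n'.+1 then rcomp1 RSucc (rconst k n') else RZero k.

Lemma reval_const k n v : reval (rconst k n) v n.
Proof. by elim: n => // n IHn; apply: (reval_comp1 IHn). Qed.

(** Out of range the projection is the constant 0, in agreement with the default of [nth 0]. *)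
Definition rproj k (i : nat) : recfun k :=
  if insub i is Some j then RProj j else RZero k.

Lemma reval_proj k i (v : k.-tuple nat) : reval (rproj k i) v (nth 0 v i).
Proof.
rewrite /rproj; case: insubP => [j _ <-|leki] /=; first by rewrite (tnth_nth 0).
by rewrite nth_default // size_tuple leqNgt.
Qed.

(** An operation travels with its code and correctness proof, so that a compiled expression, such as
    the bit test, can become a primitive of further expressions. *)
Record binop := Binop {
  bfun :> nat -> nat -> nat;
  bcode : recfun 2;
  bcodeP : forall a b, reval bcode [tuple a; b] (bfun a b)
}.

Lemma reval_prec2 (f : recfun 1) (g : recfun 3) (h : nat -> nat -> nat) :
  (forall b, reval f [tuple b] (h 0 b)) ->
  (forall a b, reval g [tuple a; h a b; b] (h a.+1 b)) ->
  forall a b, reval (RPrec f g) [tuple a; b] (h a b).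
Proof.
move=> f0 gS a b.
by apply: (@reval_prec _ _ _ [tuple b] (h^~ b)) => // n; apply: (reval_val (gS n b)).
Qed.

Lemma radd_spec a b :
  reval (RPrec (rproj 1 0) (rcomp1 RSucc (rproj 3 1))) [tuple a; b] (a + b).
Proof.
apply: (reval_prec2 (h := addn)) => [c|c d]; first exact: (reval_proj 0).
exact: (reval_comp1 (reval_proj 1 _)).
Qed.
Definition op_add := Binop radd_spec.

Lemma rmul_spec a b :
  reval (RPrec (RZero 1) (rcomp2 (bcode op_add) (rproj 3 2) (rproj 3 1)))
    [tuple a; b] (a * b).
Proof.
apply: (reval_prec2 (h := muln)) => [c|c d]; first by [].
exact: (reval_comp2 (reval_proj 2 _) (reval_proj 1 _) (bcodeP op_add _ _)).
Qed.
Definition op_mul := Binop rmul_spec.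

Lemma rpred_spec a b : reval (RPrec (RZero 1) (rproj 3 0)) [tuple a; b] a.-1.
Proof.
by apply: (reval_prec2 (h := fun a _ => a.-1)) => // c d; apply: (reval_proj 0).
Qed.
Definition op_pred := Binop rpred_spec.

(** Truncated subtraction comes with its arguments exchanged because primitive recursion runs on the
    first one. *)
Lemma rsubr_spec a b :
  reval (RPrec (rproj 1 0) (rcomp2 (bcode op_pred) (rproj 3 1) (rproj 3 1)))
    [tuple a; b] (b - a).
Proof.
apply: (reval_prec2 (h := fun a b => b - a)) => [c|c d].
  by rewrite subn0; apply: (reval_proj 0).
rewrite subnS.
exact: (reval_comp2 (reval_proj 1 _) (reval_proj 1 _) (bcodeP op_pred _ _)).
Qed.
Definition op_subr := Binop rsubr_spec.

Lemma rpow_spec a b :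
  reval (RPrec (rconst 1 1) (rcomp2 (bcode op_add) (rproj 3 1) (rproj 3 1)))
    [tuple a; b] (2 ^ a).
Proof.
apply: (reval_prec2 (h := fun a _ => 2 ^ a)) => [c|c d]; first exact: reval_const.
rewrite expnS mul2n -addnn.
exact: (reval_comp2 (reval_proj 1 _) (reval_proj 1 _) (bcodeP op_add _ _)).
Qed.
Definition op_pow := Binop rpow_spec.

Fixpoint tri (n : nat) : nat := if n is n'.+1 then n + tri n' else 0.

Lemma rtri_spec a b :
  reval (RPrec (RZero 1)
           (rcomp2 (bcode op_add) (rcomp1 RSucc (rproj 3 0)) (rproj 3 1)))
    [tuple a; b] (tri a).
Proof.
apply: (reval_prec2 (h := fun a _ => tri a)) => // c d.
have succ_c : reval (rcomp1 RSucc (rproj 3 0)) [tuple c; tri c; d] c.+1.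
  by apply: (reval_comp1 (reval_proj 0 _)).
exact: (reval_comp2 succ_c (reval_proj 1 _) (bcodeP op_add _ _)).
Qed.
Definition op_tri := Binop rtri_spec.

(** * Arithmetic expressions with bounded sums *)

Inductive expr : Type :=
| Var (i : nat)
| Cst (n : nat)
| App (o : binop) (a b : expr)
| Sum (i : nat) (b e : expr).

Definition update (v : nat -> nat) (i x : nat) : nat -> nat :=
  fun j => if Nat.eqb j i then x else v j.

Fixpoint eval (e : expr) (v : nat -> nat) : nat :=
  match e with
  | Var i => v i
  | Cst n => n
  | App o a b => o (eval a v) (eval b v)
  | Sum i b e => \sum_(0 <= x < eval b v) eval e (update v i x)
  end.

Lemma eval_ext e v w : v =1 w -> eval e v = eval e w.
Proof.
elim: e v w => //= [o a IHa b IHb|i b IHb e IHe] v w eq_vw.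
  by rewrite (IHa _ w) // (IHb _ w).
rewrite (IHb _ w) //; apply: eq_bigr => x _; apply: IHe => j.
by rewrite /update eq_vw.
Qed.

Fixpoint vars_below (k : nat) (e : expr) : bool :=
  match e with
  | Var i => i < k
  | Cst _ => true
  | App _ a b => vars_below k a && vars_below k b
  | Sum i b e => [&& i < k, vars_below k b & vars_below k e]
  end.

(** A bounded sum is a primitive recursion on the bound, which the outer composition puts in front
    of the environment. In the recursion step, argument 0 is the summation index, argument 1 is the
    partial sum and the environment is shifted by two, with slot [i] redirected to the index. *)
Fixpoint compile (k : nat) (e : expr) : recfun k :=
  match e with
  | Var i => rproj k i
  | Cst n => rconst k n
  | App o a b => rcomp2 (bcode o) (compile k a) (compile k b)
  | Sum i b e =>
      RComp
        (RPrec (RZero k)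
           (rcomp2 (bcode op_add) (rproj k.+2 1)
              (RComp (compile k e)
                 (fun j : 'I_k => rproj k.+2 (if Nat.eqb j i then 0 else j.+2)))))
        (fun j : 'I_k.+1 => if val j is j'.+1 then rproj k j' else compile k b)
  end.

Lemma reval_compile k e (v : k.-tuple nat) :
  vars_below k e -> reval (compile k e) v (eval e (nth 0 v)).
Proof.
elim: e v => [i|n|o a IHa b IHb|i b IHb e IHe] v.
- by move=> _; apply: reval_proj.
- by move=> _; apply: reval_const.
- move=> /= /andP[/IHa{}IHa /IHb{}IHb].
  exact: (reval_comp2 (IHa v) (IHb v) (bcodeP o _ _)).
move=> /and3P[ltik /IHb{}IHb /IHe{}IHe].
exists [tuple of eval b (nth 0 v) :: v]; split.
  case=> [[|j] ltj]; rewrite (tnth_nth 0) /=; first exact: IHb.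
  exact: reval_proj.
pose h n := \sum_(0 <= x < n) eval e (update (nth 0 v) i x).
apply: (@reval_prec _ _ _ v h) => [|m|]; [by rewrite /h big_geq| |by []].
rewrite /h big_nat_recr //=.
apply: (reval_comp2 (reval_proj 1 _) _ (bcodeP op_add _ _)).
pose u := [tuple nth 0 [:: m, h m & v] (if Nat.eqb j i then 0 else j.+2) | j < k].
have -> : eval e (update (nth 0 v) i m) = eval e (nth 0 u).
  apply: eval_ext => j; rewrite /update; have [ltjk|lekj] := ltnP j k.
    rewrite /u; have -> : j = Ordinal ltjk by [].
    by rewrite -[RHS](tnth_nth 0) tnth_mktuple /=; case: Nat.eqb.
  (* Beyond [k] both sides read the default 0; the updated slot [i] lies below [k]. *)
  rewrite !nth_default ?size_tuple //; case: PeanoNat.Nat.eqb_spec => // ji.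
  by rewrite ji leqNgt ltik in lekj.
apply: (@reval_comp _ _ _ _ _ (tnth u)) => [j|].
  by rewrite tnth_mktuple; apply: reval_proj.
apply: (reval_val (IHe u)).
by congr val; apply: eq_from_tnth => j; rewrite tnth_mktuple.
Qed.

Definition env2 (a b : nat) : nat -> nat := nth 0 [:: a; b].

Definition nvars := 16.

(** The arguments fill slots 0 and 1; all other slots start at 0, since [rproj 2 i] is then out of
    range. *)
Lemma binop_of_proof e : vars_below nvars e -> forall a b,
  reval (RComp (compile nvars e) (fun i : 'I_nvars => rproj 2 i)) [tuple a; b]
    (eval e (env2 a b)).
Proof.
move=> ok a b; pose u := [tuple nth 0 [:: a; b] i | i < nvars].
have -> : eval e (env2 a b) = eval e (nth 0 u).
  apply: eval_ext => j; rewrite /env2; have [ltjk|lekj] := ltnP j nvars.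
    by have -> : j = Ordinal ltjk by []; rewrite -[RHS](tnth_nth 0) tnth_mktuple.
  by rewrite !nth_default ?size_tuple //=; apply: leq_trans lekj.
apply: (@reval_comp _ _ _ _ _ (tnth u)) => [j|].
  by rewrite tnth_mktuple; apply: reval_proj.
apply: (reval_val (reval_compile u ok)).
by congr val; apply: eq_from_tnth => j; rewrite tnth_mktuple.
Qed.
Definition binop_of e (ok : vars_below nvars e) : binop := Binop (binop_of_proof ok).

(** * Reduction to static formulas *)

Scheme action_mutind := Induction for action Sort Prop
  with formula_mutind := Induction for formula Sort Prop.
Combined Scheme action_formula_ind from action_mutind, formula_mutind.

Section Reduction.

Variables F Omega : countType.

Inductive sform : Type :=
| SLab (w : Omega)
| SBot
| SNeg (s : sform)
| SOr (s t : sform)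
| SBoxE (a : F) (s : sform)
| SBoxU (s : sform).

Fixpoint ssat (s : sform) (G : termgraph F Omega) : Prop :=
  match s with
  | SLab w => nlabel G (root G) w
  | SBot => False
  | SNeg s => ~ ssat s G
  | SOr s t => ssat s G \/ ssat t G
  | SBoxE a s => forall e : edge G,
      source G e = root G -> elabel G e = a -> ssat s (reroot (target G e))
  | SBoxU s => forall m : node G, ssat s (reroot m)
  end.

Lemma ssat_or s t G : ssat (SOr s t) G <-> ssat s G \/ ssat t G.
Proof. by []. Qed.

Definition SAnd s t := SNeg (SOr (SNeg s) (SNeg t)).

Lemma ssat_and s t G : ssat (SAnd s t) G <-> ssat s G /\ ssat t G.
Proof. by split=> /=; tauto. Qed.

Inductive modifier : Type :=
| MNode
| MRoot
| MAssign (w : Omega) (p : sform)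
| MAdd (a : F) (p q : sform)
| MDel (a : F) (p q : sform).

Definition modify (d : modifier) (G : termgraph F Omega) : termgraph F Omega :=
  match d with
  | MNode => add_node G
  | MRoot => @reroot F Omega (add_node G) None
  | MAssign w p =>
      relabel (fun m => assign w (ssat p (reroot m)) (nlabel G m))
  | MAdd a p q =>
      add_edges a (fun m : node G => ssat p (reroot m))
                  (fun m : node G => ssat q (reroot m))
  | MDel a p q =>
      del_edges a (fun m : node G => ssat p (reroot m))
                  (fun m : node G => ssat q (reroot m))
  end.

(** The guards [p] and [q] are left as they are because they refer to the graph before the change. A
    new node has no edges, so edge boxes hold there, while universal boxes must also inspect it.
    Added edges leave the root only if [p] holds there, and lead to all [q]-nodes. Under deletion,
    either all old edges satisfy the box, or [p] holds and only targets outside [q] matter. *)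
Fixpoint reduce (s : sform) (d : modifier) : sform :=
  match s with
  | SLab w =>
      match d with
      | MRoot => SBot
      | MAssign w' p => if w' == w then p else SLab w
      | _ => SLab w
      end
  | SBot => SBot
  | SNeg s => SNeg (reduce s d)
  | SOr s t => SOr (reduce s d) (reduce t d)
  | SBoxU s =>
      match d with
      | MNode | MRoot => SAnd (SBoxU (reduce s MNode)) (reduce s MRoot)
      | _ => SBoxU (reduce s d)
      end
  | SBoxE b s =>
      match d with
      | MRoot => SNeg SBot
      | MAdd a p q =>
          if a == b then
            SAnd (SBoxE b (reduce s d))
                 (SOr (SNeg p) (SBoxU (SOr (SNeg q) (reduce s d))))
          else SBoxE b (reduce s d)
      | MDel a p q =>
          if a == b then
            SOr (SBoxE b (reduce s d)) (SAnd p (SBoxE b (SOr q (reduce s d))))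
          else SBoxE b (reduce s d)
      | _ => SBoxE b (reduce s d)
      end
  end.

(** Induction on [s] with [d] and [G] general: a universal box after [MNode] or [MRoot] calls for
    both modifiers, and boxes move the root. *)
Lemma ssat_reduce s d G : ssat (reduce s d) G <-> ssat s (modify d G).
Proof.
elim: s d G => [w||s IH|s IHs t IHt|b s IH|s IH] d G.
- case: d => //= w' p; rewrite /assign; case: G => N E nl el S T r /=.
  case: eqP => [->|ne] /=; first by rewrite /reroot /=; tauto.
  have ne' : w <> w' by move=> e; apply: ne.
  by have := classic (ssat p (reroot (G := Termgraph nl el S T r) r)); tauto.
- by [].
- by rewrite /= IH.
- by rewrite /= IHs IHt.
- case: d => [||w p|a p q|a p q].
  + split=> /= H.
      by move=> e [/H{}H] /H; rewrite IH.
    by move=> e se le; rewrite IH; apply: H => //=; rewrite se.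
  + by split=> /= [_ e|_ []].
  + by split=> /= H e /H{}H /H; rewrite IH.
  + have inl_ok : (forall e : edge G, source G e = root G -> elabel G e = b ->
        ssat (reduce s (MAdd a p q)) (reroot (target G e))) <->
      (forall e : edge G, source G e = root G -> elabel G e = b ->
        ssat s (reroot (G := modify (MAdd a p q) G) (target G e))).
      by split=> H e /H{}H /H; rewrite IH.
    rewrite [reduce _ _]/=; case: eqP => [->|ne].
      rewrite ssat_and /=; split=> [[H1 H2]|H].
        case=> [e|[[m m'] [/= pm qm]]] /=; first by move=> /H1{}H1 /H1; rewrite IH.
        move=> mr _; case: H2; first by case; rewrite mr in pm; case: (G) pm.
        by move=> /(_ m') [|/=]; [case | rewrite IH].
      split=> [e se le|/=]; first by rewrite IH; apply: (H (inl e)).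
      case: (classic (ssat p G)) => [pG|]; last by left.
      right=> m; case: (classic (ssat q (reroot m))) => [qm|]; last by left.
      right; rewrite IH.
      (* [G] is convertible to [reroot (root G)] only after [G] is destructed. *)
      have pr : ssat p (reroot (root G)) by case: (G) pG.
      by apply: (H (inr (exist _ (root G, m) (conj pr qm)))).
    rewrite /=; rewrite inl_ok; split=> H; last by move=> e; apply: (H (inl e)).
    by case=> [e|e] /=; [apply: H | move=> _ /ne].
  + rewrite [reduce _ _]/=; case: eqP => [->|ne].
      rewrite ssat_or ssat_and /=.
      have E : ssat p (reroot (root G)) <-> ssat p G by case: (G).
      split=> [[H|[pG H]] [e /= ne] se le|H].
      * by have := H e se le; rewrite IH.
      * case: (H e se le) => [qe|]; last by rewrite IH.
        by case: ne; split; rewrite ?se ?E.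
      * case: (classic (ssat p G)) => [pG|npG].
          right; split=> // e se le.
          case: (classic (ssat q (reroot (target G e)))) => [qe|nqe]; first by left.
          right; rewrite IH.
          have ne : ~ [/\ elabel G e = b, ssat p (reroot (source G e)) & ssat q (reroot (target G e))] by case.
          exact: (H (exist _ e ne)).
        left=> e se le; rewrite IH.
        have ne : ~ [/\ elabel G e = b, ssat p (reroot (source G e)) & ssat q (reroot (target G e))].
          by case=> _; rewrite se E.
        exact: (H (exist _ e ne)).
    rewrite /=; split=> H.
      by case=> e /= ne' se le; have := H e se le; rewrite IH.
    move=> e se le; rewrite IH.
    have ne' : ~ [/\ elabel G e = a, ssat p (reroot (source G e)) & ssat q (reroot (target G e))].
      by rewrite le; case=> /esym.
    exact: (H (exist _ e ne')).
- case: d => [||w p|a p q|a p q].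
  1,2: rewrite [reduce _ _]/= ssat_and /=; split=> [[H1 H2] [m|]|H].
  1,4: by have := H1 m; rewrite IH.
  1,3: by have := H2; rewrite IH.
  1,2: by split=> [m|]; rewrite IH; [apply: (H (Some m)) | apply: (H None)].
  all: by split=> /= H m; have := H m; rewrite IH.
Qed.

(** * The fragment test and the translation of formulas *)

Fixpoint flagA (alpha : action F Omega) : nat :=
  match alpha with
  | Edge _ | Univ | NewNode | NewRoot => 0
  | Test phi | GlobalAssign _ phi => flagF phi
  | LocalAssign _ _ | Star _ => 1
  | AddEdges _ phi psi | DelEdges _ phi psi => flagF phi + flagF psi
  | Seq beta gamma | Choice beta gamma => flagA beta + flagA gamma
  end
with flagF (phi : formula F Omega) : nat :=
  match phi with
  | Label _ | Bot => 0
  | Neg psi => flagF psi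
  | Or psi chi => flagF psi + flagF chi
  | Box alpha psi => flagF psi + flagA alpha
  end.

Lemma flag_eq0 :
  (forall alpha, (flagA alpha == 0) =
     ~~ action_occurs (@is_local_assign F Omega) alpha &&
     ~~ action_occurs (@is_star F Omega) alpha) /\
  (forall phi, (flagF phi == 0) =
     ~~ formula_occurs (@is_local_assign F Omega) phi &&
     ~~ formula_occurs (@is_star F Omega) phi).
Proof.
apply: action_formula_ind => //=.
- by move=> _ p Hp q Hq; rewrite addn_eq0 Hp Hq !negb_or; do !case: formula_occurs.
- by move=> _ p Hp q Hq; rewrite addn_eq0 Hp Hq !negb_or; do !case: formula_occurs.
- by move=> p Hp q Hq; rewrite addn_eq0 Hp Hq !negb_or; do !case: action_occurs.
- by move=> p Hp q Hq; rewrite addn_eq0 Hp Hq !negb_or; do !case: action_occurs.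
- by move=> p Hp; rewrite andbF.
- by move=> p Hp q Hq; rewrite addn_eq0 Hp Hq !negb_or; do !case: formula_occurs.
- by move=> p Hp q Hq; rewrite addn_eq0 Hp Hq !negb_or; do !case: action_occurs; do !case: formula_occurs.
Qed.

(** A weakest precondition transformer: taking the static postcondition as an argument makes
    sequencing a composition and keeps the mutual recursion structural. *)
Fixpoint box (alpha : action F Omega) (s : sform) : sform :=
  match alpha with
  | Edge a => SBoxE a s
  | Univ => SBoxU s
  | NewNode => reduce s MNode
  | NewRoot => reduce s MRoot
  | Test phi => SOr (SNeg (static phi)) s
  | GlobalAssign w phi => reduce s (MAssign w (static phi))
  | AddEdges a phi psi => reduce s (MAdd a (static phi) (static psi))
  | DelEdges a phi psi => reduce s (MDel a (static phi) (static psi))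
  | Seq beta gamma => box beta (box gamma s)
  | Choice beta gamma => SAnd (box beta s) (box gamma s)
  | LocalAssign _ _ | Star _ => s
  end
with static (phi : formula F Omega) : sform :=
  match phi with
  | Label w => SLab w
  | Bot => SBot
  | Neg psi => SNeg (static psi)
  | Or psi chi => SOr (static psi) (static chi)
  | Box alpha psi => box alpha (static psi)
  end.

Lemma sat_static :
  (forall alpha, flagA alpha = 0 -> forall s G,
     ssat (box alpha s) G <-> (forall G', step alpha G G' -> ssat s G')) /\
  (forall phi, flagF phi = 0 -> forall G, ssat (static phi) G <-> sat phi G).
Proof.
(* [step] relates graphs by equality, so equivalent guards have to be made equal by
   extensionality. *)
have ext G phi : (forall G, ssat (static phi) G <-> sat phi G) ->
    (fun m : node G => sat phi (reroot m)) = (fun m => ssat (static phi) (reroot m)).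
  by move=> H; apply: functional_extensionality => m; apply: propositional_extensionality; rewrite H.
apply: action_formula_ind => //=.
- move=> a _ s G; split=> [H G' [e [se le ->]]|H e se le]; first exact: H.
  by apply: H; exists e.
- move=> _ s G; split=> [H G' [m ->]|H m]; first exact: H.
  by apply: H; exists m.
- by move=> _ s G; rewrite ssat_reduce; split=> [H G' ->|H] //; apply: H.
- by move=> _ s G; rewrite ssat_reduce; split=> [H G' ->|H] //; apply: H.
- move=> phi IH /IH{}IH s G; rewrite IH; split=> [H G' [-> ?]|H]; first by case: H.
  by case: (classic (sat phi G)) => ?; [right; apply: H | left].
- move=> w phi IH /IH{}IH s G; rewrite ssat_reduce /=.
  have -> : (fun m => assign w (sat phi (reroot m)) (nlabel G m)) =
            (fun m => assign w (ssat (static phi) (reroot m)) (nlabel G m)).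
    apply: functional_extensionality => m; congr assign.
    by apply: propositional_extensionality; rewrite IH.
  by split=> [H G' ->|H] //; apply: H.
- move=> a phi IH psi IH' /eqP; rewrite addn_eq0 => /andP[/eqP/IH{}IH /eqP/IH'{}IH'] s G.
  rewrite ssat_reduce /= !ext //.
  by split=> [H G' ->|H] //; apply: H.
- move=> a phi IH psi IH' /eqP; rewrite addn_eq0 => /andP[/eqP/IH{}IH /eqP/IH'{}IH'] s G.
  rewrite ssat_reduce /= !ext //.
  by split=> [H G' ->|H] //; apply: H.
- move=> a IHa b IHb /eqP; rewrite addn_eq0 => /andP[/eqP/IHa{}IHa /eqP/IHb{}IHb] s G.
  rewrite IHa; split=> [H G' [G1 [/H + bG]]|H G1 aG1]; first by rewrite IHb; apply.
  by rewrite IHb => G' bG; apply: H; exists G1.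
- move=> a IHa b IHb /eqP; rewrite addn_eq0 => /andP[/eqP/IHa{}IHa /eqP/IHb{}IHb] s G.
  rewrite -[X in X <-> _]/(ssat (SAnd (box a s) (box b s)) G) ssat_and IHa IHb; split=> [[H1 H2] G' []|H]; [exact: H1 | exact: H2 |].
  by split=> G' ?; apply: H; [left|right].
- by move=> phi IH /IH{}IH G; rewrite IH.
- move=> a IHa b IHb /eqP; rewrite addn_eq0 => /andP[/eqP/IHa{}IHa /eqP/IHb{}IHb] G.
  by rewrite IHa IHb.
- move=> a IHa b IHb /eqP; rewrite addn_eq0 => /andP[/eqP/IHb{}IHb /eqP/IHa{}IHa] G.
  by rewrite IHa; split=> H G' /H; rewrite IHb.
Qed.

End Reduction.

(** * Types and validity of static formulas *)

(** A number codes the finite set of the positions of its binary digits 1. *)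
Definition bit (x T : nat) : bool := odd (T %/ 2 ^ x).

Lemma bit_lt x T : bit x T -> x < T.
Proof.
move=> xT; apply: leq_trans (ltn_expl x (isT : 1 < 2)) _.
by rewrite leqNgt; apply/negP => /divn_small E; rewrite /bit E in xT.
Qed.

(** Finite comprehension: excluded middle decides the membership of each number, and putting [N]
    into the set adds [2 ^ N] to its code. *)
Lemma set_exists N (P : nat -> Prop) :
  exists2 T, T < 2 ^ N & forall x, bit x T <-> x < N /\ P x.
Proof.
elim: N => [|N [T ltT IH]].
  by exists 0 => // x; rewrite /bit div0n; split=> // -[].
case: (classic (P N)) => [PN|nPN]; last first.
  exists T; first by rewrite expnS; apply: leq_trans ltT _; rewrite leq_pmull.
  move=> x; rewrite IH ltnS; split=> [[ltx Px]|[]]; first by rewrite ltnW.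
  by rewrite leq_eqVlt => /predU1P[->|].
exists (2 ^ N + T); first by rewrite expnS mul2n -addnn ltn_add2l.
move=> x; rewrite /bit; case: (ltngtP x N) => [ltx|ltN|->].
(* At positions below [N] the added term contributes an even quotient, so the parity does not
   change. *)
- have -> : 2 ^ N = 2 ^ (N - x).-1 * 2 * 2 ^ x.
    by rewrite -expnSr prednK ?subn_gt0 // -expnD subnK // ltnW.
  rewrite divnMDl ?expn_gt0 // oddD oddM andbF /= -/(bit x T) IH ltx.
  by rewrite ltnS ltnW.
- rewrite divn_small; last first.
    apply: leq_trans (leq_pexp2l (isT : 0 < 2) ltN).
    by rewrite expnS mul2n -addnn ltn_add2l.
  by rewrite ltnNge ltN /=; split=> // -[].
- rewrite divnDl // divnn expn_gt0 /= (divn_small ltT) addn0.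
  by split.
Qed.

(** Cantor pairing, with the triangular numbers given by a function that has a code. *)
Definition pr (x y : nat) : nat := y + tri (x + y).

Lemma to_natE x y : Cantor.to_nat (x, y) = pr x y.
Proof.
change (y + nat_rec _ 0 (fun i m => i.+1 + m) (y + x) = y + tri (x + y)).
by rewrite [x + y]addnC; congr (_ + _); elim: (y + x) => //= n ->.
Qed.

Lemma pr_inj x y x' y' : pr x y = pr x' y' -> x = x' /\ y = y'.
Proof. by rewrite -!to_natE => /Cantor.to_nat_inj[]. Qed.

Lemma leq_tri n : n <= tri n.
Proof. by case: n => //= n; apply: leq_addr. Qed.

Lemma leq_pr2 x y : y <= pr x y.
Proof. exact: leq_addr. Qed.

Lemma leq_pr1 x y : x <= pr x y.
Proof. by rewrite /pr; have := leq_tri (x + y); lia. Qed.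

Lemma rpr_spec a b :
  reval (rcomp2 (bcode op_add) (rproj 2 1)
     (rcomp2 (bcode op_tri) (rcomp2 (bcode op_add) (rproj 2 0) (rproj 2 1)) (RZero 2)))
    [tuple a; b] (pr a b).
Proof.
apply: (reval_comp2 (reval_proj 1 _) _ (bcodeP op_add _ _)).
apply: (reval_comp2 (x2 := 0) _ _ (bcodeP op_tri _ _)) => //.
exact: (reval_comp2 (reval_proj 0 _) (reval_proj 1 _) (bcodeP op_add _ _)).
Qed.
Definition op_pair := Binop rpr_spec.

Section Types.

Variables F Omega : countType.
Notation sform := (sform F Omega).
Notation termgraph := (termgraph F Omega).

(** A code is at least as large as the codes of the constituents, so the formulas with code below
    [n] are closed under subformulas. *)
Fixpoint scode (s : sform) : nat :=
  match s with
  | SLab w => pr 1 (pickle w)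
  | SBot => pr 2 0
  | SNeg s => pr 3 (scode s)
  | SOr s t => pr 4 (pr (scode s) (scode t))
  | SBoxE a s => pr 5 (pr (pickle a) (scode s))
  | SBoxU s => pr 6 (scode s)
  end.

Lemma pickle_inj (T : countType) : injective (@pickle T).
Proof. exact: pcan_inj pickleK. Qed.

Lemma scode_inj : injective scode.
Proof.
elim=> [w||s IH|s IHs t IHt|a s IH|s IH] [w'||s'|s' t'|a' s'|s'] //= /pr_inj[] //.
- by move=> _ /pickle_inj->.
- by move=> _ /IH->.
- by move=> _ /pr_inj[/IHs-> /IHt->].
- by move=> _ /pr_inj[/pickle_inj-> /IH->].
- by move=> _ /IH->.
Qed.

(** [S] is a set of subformula codes and [H] a set of types, each type being the
    set of formulas of [S] true at some node. *)
Definition coherent (n S H : nat) : Prop :=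
  (forall t, t < H -> bit t H -> ~ bit (pr 2 0) t) /\
  (forall p, p < n ->
    (bit (pr 3 p) S -> bit p S /\
       forall t, t < H -> bit t H -> (bit (pr 3 p) t <-> ~ bit p t)) /\
    (forall q, q < n -> bit (pr 4 (pr p q)) S -> bit p S /\ bit q S /\
       forall t, t < H -> bit t H ->
         (bit (pr 4 (pr p q)) t <-> bit p t \/ bit q t)) /\
    (bit (pr 6 p) S -> bit p S /\
       forall t, t < H -> bit t H ->
         (bit (pr 6 p) t <-> forall u, u < H -> bit u H -> bit p u)) /\
    (forall a, a < n -> bit (pr 5 (pr a p)) S -> bit p S /\
       forall t, t < H -> bit t H -> ~ bit (pr 5 (pr a p)) t ->
         exists u, u < H /\ (bit u H /\ ~ bit p u /\
           forall q, q < n -> bit (pr 5 (pr a q)) t -> bit q u))).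

(** The bounds exhaust the codes of sets of numbers below [n] and of sets of such sets, which makes
    validity a bounded statement. *)
Definition type_valid (n y : nat) : Prop :=
  forall S, S < 2 ^ n -> forall H, H < 2 ^ (2 ^ n) ->
    bit y S -> coherent n S H -> forall t, t < H -> bit t H -> bit y t.

(** The largest edge relation of a filtration: an [a]-edge joins two types as soon as the second
    contains the body, if below [n], of every [a]-box in the first. *)
Definition type_graph (n H : nat) (t : {t | bit t H}) : termgraph :=
  @Termgraph F Omega {t | bit t H}
    {e : F * ({t | bit t H} * {t | bit t H}) |
       forall q, q < n -> bit (pr 5 (pr (pickle e.1) q)) (sval e.2.1) ->
         bit q (sval e.2.2)}
    (fun t w => bit (pr 1 (pickle w)) (sval t))
    (fun e => (sval e).1) (fun e => (sval e).2.1) (fun e => (sval e).2.2) t.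

(** The truth lemma, by induction on [s]. For an edge box, the condition on edges shows that
    membership implies truth, and the witness clause of [coherent] gives the converse. *)
Lemma ssat_type_graph n S H : coherent n S H ->
  forall s, scode s < n -> bit (scode s) S ->
  forall t : {t | bit t H}, ssat s (type_graph n t) <-> bit (scode s) (sval t).
Proof.
case=> bot_ok coh; elim=> [w||s IH|s IHs u IHu|a s IH|s IH] /= ltn inS t;
  (* A member of a coded set is less than the code, so the bound [H] on types in [coherent] excludes
     no type of the set. *)
  have [tH tlt] := (svalP t, bit_lt (svalP t)).
- by [].
- by split=> // /(bot_ok _ tlt tH).
- have lt_s : scode s < n by apply: leq_ltn_trans ltn; apply: leq_pr2.
  have [/(_ inS)[sS E] _] := coh _ lt_s.
  by rewrite (E _ tlt tH) IH.
- have lt_s : scode s < n.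
    apply: leq_ltn_trans ltn; apply: leq_trans (leq_pr2 _ _); exact: leq_pr1.
  have lt_u : scode u < n.
    apply: leq_ltn_trans ltn; apply: leq_trans (leq_pr2 _ _); exact: leq_pr2.
  have [_ [/(_ _ lt_u inS)[sS [uS E]] _]] := coh _ lt_s.
  by rewrite (E _ tlt tH) IHs // IHu.
- have lt_s : scode s < n.
    apply: leq_ltn_trans ltn; apply: leq_trans (leq_pr2 _ _); exact: leq_pr2.
  have lt_a : pickle a < n.
    apply: leq_ltn_trans ltn; apply: leq_trans (leq_pr2 _ _); exact: leq_pr1.
  have [_ [_ [_ /(_ _ lt_a inS)[sS cE]]]] := coh _ lt_s.
  split=> [box_s|box_t].
    apply: NNPP => /(cE _ tlt tH)[u [_ [uH [nsu Ru]]]].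
    pose e : edge (type_graph n t) := exist _ (a, (t, exist _ u uH)) Ru.
    by apply: nsu; have := box_s e erefl erefl; rewrite -[reroot _]/(type_graph n _) IH.
  case=> [[b [v u]] /= Rvu] vt ba; rewrite vt ba in Rvu.
  by rewrite -[reroot _]/(type_graph n _) IH //=; apply: Rvu.
- have lt_s : scode s < n by apply: leq_ltn_trans ltn; apply: leq_pr2.
  have [_ [_ [/(_ inS)[sS E] _]]] := coh _ lt_s; rewrite (E _ tlt tH).
  split=> [Hs u _ uH|Hs u]; last first.
    by rewrite -[reroot _]/(type_graph n _) IH //; apply: Hs; [apply: bit_lt|]; apply: (svalP u).
  by have := Hs (exist _ u uH); rewrite -[reroot _]/(type_graph n _) IH.
Qed.

(** * Types realised in a given graph *)

Definition is_type (G : termgraph) (n t : nat) (m : node G) : Prop :=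
  forall x, bit x t <-> x < n /\ exists s, scode s = x /\ ssat s (reroot m).

Lemma is_type_bit G n t m s : @is_type G n t m -> scode s < n ->
  bit (scode s) t <-> ssat s (reroot m).
Proof.
by move=> -> ->; split=> [[_ [s' [/scode_inj-> //]]]|Hs]; split=> //; exists s.
Qed.

Lemma scode_neg s p : scode s = pr 3 p -> exists2 s', s = SNeg s' & scode s' = p.
Proof. by case: s => [w||s|s t|a s|s] /= /pr_inj[] // _ <-; exists s. Qed.

Lemma scode_or s p q : scode s = pr 4 (pr p q) ->
  exists s1 s2, [/\ s = SOr s1 s2, scode s1 = p & scode s2 = q].
Proof.
by case: s => [w||s|s t|a s|s] /= /pr_inj[] // _ /pr_inj[<- <-]; exists s, t.
Qed.

Lemma scode_boxE s n p : scode s = pr 5 (pr n p) ->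
  exists a s', [/\ s = SBoxE a s', pickle a = n & scode s' = p].
Proof.
by case: s => [w||s|s t|a s|s] /= /pr_inj[] // _ /pr_inj[<- <-]; exists a, s.
Qed.

Lemma scode_boxU s p : scode s = pr 6 p -> exists2 s', s = SBoxU s' & scode s' = p.
Proof. by case: s => [w||s|s t|a s|s] /= /pr_inj[] // _ <-; exists s. Qed.

(** When an edge box fails at a node, an offending edge provides the witness: the type of its target
    contains the bodies of all boxes with that label that hold at the source. The other clauses are
    the truth conditions. *)
Lemma coherent_types (G : termgraph) n S H :
  (forall x, bit x S <-> x < n /\ exists s, scode s = x) ->
  (forall t, bit t H <-> t < 2 ^ n /\ exists m : node G, is_type n t m) ->
  coherent n S H.
Proof.
move=> SP HP.
have sub s : scode s < n -> bit (scode s) S by move=> lt; rewrite SP; split=> //; exists s.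
(* Every node has its type in [H], so quantifying over [H] amounts to quantifying over nodes. *)
have typ (m : node G) : exists2 t, bit t H & is_type n t m.
  have [t ltt tP] := set_exists n (fun x => exists s, scode s = x /\ ssat s (reroot m)).
  by exists t => //; rewrite HP; split=> //; exists m.
split.
  move=> t _ /HP[_ [m tP]] /[dup] /tP[lt _].
  by rewrite -[pr 2 0]/(scode (SBot _ _)) (is_type_bit tP).
move=> p ltp; split; [|split; [|split]].
- case/SP=> lt [s0 /[dup] /scode_neg[s -> Es] Ens]; rewrite -{}Es in lt ltp Ens *.
  split; first exact: sub.
  by move=> t _ /HP[_ [m tP]]; rewrite -Ens in lt *; rewrite !(is_type_bit tP).
- move=> q ltq /SP[lt [s0 /[dup] /scode_or[s1 [s2 [-> E1 E2]]] Eo]].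
  rewrite -{}E1 -{}E2 in lt ltp ltq Eo *; split; [|split]; [exact: sub | exact: sub |].
  by move=> t _ /HP[_ [m tP]]; rewrite -Eo in lt *; rewrite !(is_type_bit tP).
- case/SP=> lt [s0 /[dup] /scode_boxU[s -> Es] Ens]; rewrite -{}Es in lt ltp Ens *.
  split; first exact: sub.
  move=> t _ /HP[_ [m tP]]; rewrite -Ens in lt *; rewrite (is_type_bit tP) //=.
  split=> [Hs u _ /HP[_ [m' uP]]|Hs m']; first by rewrite (is_type_bit uP) //; apply: Hs.
  have [u uH uP] := typ m'; rewrite -[ssat _ _]/(ssat s (reroot m')).
  by rewrite -(is_type_bit uP) //; apply: Hs => //; apply: bit_lt.
- move=> n' ltn' /SP[lt [s0 /[dup] /scode_boxE[a [s [-> Ea Es]]] Eb]].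
  rewrite -{}Ea -{}Es in lt ltp ltn' Eb *; split; first exact: sub.
  move=> t _ /HP[_ [m tP]]; rewrite -Eb in lt *; rewrite (is_type_bit tP) //= => nbox.
  have [e [se le ns]] : exists e : edge G,
      [/\ source G e = m, elabel G e = a & ~ ssat s (reroot (target G e))].
    apply: NNPP => ne; apply: nbox => e se le; apply: NNPP => ns.
    by apply: ne; exists e.
  have [u uH uP] := typ (target G e).
  exists u; split; [exact: bit_lt | split=> //; split; first by rewrite (is_type_bit uP)].
  move=> q ltq bt; have [lt' _] := proj1 (tP _) bt.
  have [_ [s' [Es' Hs']]] := proj1 (tP _) bt.
  have [b [s2 [Es2 /pickle_inj Eb' Eq]]] := scode_boxE Es'.
  by rewrite -Eq in ltq *; rewrite (is_type_bit uP) //; rewrite Es2 Eb' in Hs'; apply: Hs'.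
Qed.

(** A type in a coherent set is the root of a type graph, where truth is membership; conversely, the
    type of the root of [G] lies in the coherent set realised by [G]. The bound is one above the
    code so that [s] itself is included. *)
Lemma type_validP s :
  type_valid (scode s).+1 (scode s) <-> forall G : termgraph, ssat s G.
Proof.
set n := (scode s).+1; split=> [valid G|valid S ltS H ltH sS coh t _ tH]; last first.
  by have := valid (type_graph n (exist _ t tH)); rewrite (ssat_type_graph coh).
have [S ltS SP] := set_exists n (fun x => exists s, scode s = x).
have [H ltH HP] := set_exists (2 ^ n) (fun t => exists m : node G, is_type n t m).
have coh := coherent_types SP HP.
have [t ltt tP] := set_exists n (fun x => exists s, scode s = x /\ ssat s (reroot (root G))).
have tH : bit t H by rewrite HP; split=> //; exists (root G).
have sS : bit (scode s) S by rewrite SP; split=> //; exists s.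
have := valid S ltS H ltH sS coh t (bit_lt tH) tH.
by rewrite (is_type_bit (m := root G) tP) //; case: (G).
Qed.

End Types.

(** * Formulas with bounded quantifiers, and tables closed under Horn clauses *)

Arguments pr : simpl never.
Arguments bit : simpl never.

Notation EAdd := (App op_add).
Notation EPair := (App op_pair).
Notation EPow a := (App op_pow a (Cst 0)).
(** Zero stands for falsity and every positive number for truth; as [op_subr] exchanges its
    arguments, [ENot a] is one minus [a]. *)
Notation ENot a := (App op_subr a (Cst 1)).
Notation EEq a b := (ENot (EAdd (App op_subr a b) (App op_subr b a))).

Lemma eval_not a v : (0 < eval (ENot a) v) <-> ~ (0 < eval a v).
Proof. by rewrite /=; split; lia. Qed.

Lemma eval_eq a b v : (0 < eval (EEq a b) v) <-> eval a v = eval b v.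
Proof. by rewrite /=; split; lia. Qed.

Lemma eval_sum i b e v :
  (0 < eval (Sum i b e) v) <->
  exists x, x < eval b v /\ 0 < eval e (update v i x).
Proof.
rewrite /= big_mkord lt0n sum_nat_eq0 negb_forall.
split=> [/existsP[x]|[x [ltx ex]]]; first by rewrite -lt0n; exists x.
by apply/existsP; exists (Ordinal ltx); rewrite -lt0n.
Qed.

(** The digit of [T] at position [x] is 1 iff [T = (2q + 1) * 2 ^ x + r] for some [q] and some
    [r < 2 ^ x]; slots 0 to 3 hold [x], [T], [q] and [r]. *)
Definition bit_expr : expr :=
  Sum 2 (EAdd (Var 1) (Cst 1)) (Sum 3 (EPow (Var 0))
    (EEq (Var 1)
       (EAdd (App op_mul (EAdd (EAdd (Var 2) (Var 2)) (Cst 1)) (EPow (Var 0)))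
             (Var 3)))).

Definition op_bit : binop := @binop_of bit_expr isT.

Lemma op_bitE x T : (0 < op_bit x T) <-> bit x T.
Proof.
rewrite -[op_bit x T]/(eval bit_expr (env2 x T)) eval_sum; split.
  case=> q [_ /eval_sum[r [ltr /eval_eq E]]]; move: ltr E.
  rewrite /= /env2 /update /= => ltr ->.
  by rewrite /bit divnMDl ?expn_gt0 // divn_small // addn0 addn1 addnn /= odd_double.
move=> oddq; exists (T %/ 2 ^ x)./2; split.
  by rewrite /= /env2 /=; have := leq_div T (2 ^ x); lia.
apply/eval_sum; exists (T %% 2 ^ x); split; first by rewrite /= ltn_mod expn_gt0.
apply/eval_eq; rewrite /= /env2 /update /=.
have -> : (T %/ 2 ^ x)./2 + (T %/ 2 ^ x)./2 + 1 = T %/ 2 ^ x.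
  by rewrite addnn addn1 -[RHS]odd_double_half; move: oddq; rewrite /bit => ->.
exact: divn_eq.
Qed.

(** * Bounded formulas and their characteristic expressions *)

Inductive fm : Type :=
| FEq (a b : expr)
| FBit (a b : expr)
| FNot (f : fm)
| FAnd (f g : fm)
| FOr (f g : fm)
| FImp (f g : fm)
| FIff (f g : fm)
| FEx (i : nat) (b : expr) (f : fm)
| FAll (i : nat) (b : expr) (f : fm).

Fixpoint den (f : fm) (v : nat -> nat) : Prop :=
  match f with
  | FEq a b => eval a v = eval b v
  | FBit a b => bit (eval a v) (eval b v)
  | FNot f => ~ den f v
  | FAnd f g => den f v /\ den g v
  | FOr f g => den f v \/ den g v
  | FImp f g => den f v -> den g v
  | FIff f g => den f v <-> den g v
  | FEx i b f => exists x, x < eval b v /\ den f (update v i x)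
  | FAll i b f => forall x, x < eval b v -> den f (update v i x)
  end.

(** Positive truth values may differ, so [FIff] compares negations, which are 0 or 1. *)
Fixpoint fm_expr (f : fm) : expr :=
  match f with
  | FEq a b => EEq a b
  | FBit a b => App op_bit a b
  | FNot f => ENot (fm_expr f)
  | FAnd f g => App op_mul (fm_expr f) (fm_expr g)
  | FOr f g => EAdd (fm_expr f) (fm_expr g)
  | FImp f g => EAdd (ENot (fm_expr f)) (fm_expr g)
  | FIff f g => EEq (ENot (fm_expr f)) (ENot (fm_expr g))
  | FEx i b f => Sum i b (fm_expr f)
  | FAll i b f => ENot (Sum i b (ENot (fm_expr f)))
  end.

Lemma fm_exprP f v : (0 < eval (fm_expr f) v) <-> den f v.
Proof.
elim: f v => [a b|a b|f IH|f IHf g IHg|f IHf g IHg|f IHf g IHg|f IHf g IHg|i b f IH|i b f IH] v.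
- exact: eval_eq.
- exact: op_bitE.
- by rewrite eval_not IH.
- by rewrite /= -IHf -IHg muln_gt0; split=> /andP.
- by rewrite /= -IHf -IHg addn_gt0; split=> /orP.
- rewrite /= -IHf -IHg; case: (eval (fm_expr f) v) => [|a]; last by split=> [? _|]; [lia | move=> H; have := H isT; lia].
  by split.
- rewrite /= -IHf -IHg.
  by case: (eval (fm_expr f) v) => [|a]; case: (eval (fm_expr g) v) => [|b]; split; lia.
- rewrite eval_sum /=.
  by split=> -[x [ltx fx]]; exists x; split=> //; apply/IH.
- rewrite eval_not eval_sum /=; split=> [ne x ltx|all [x [ltx]]].
    by apply/IH; apply: NNPP => nf; apply: ne; exists x; split=> //; apply/eval_not.
  by move/eval_not; apply; apply/IH; apply: all.
Qed.

(** * Horn clauses, derivations and finite tables *)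

Section Clauses.

Record clause := Clause {
  conc : expr;
  prems : seq expr;
  neqs : seq (expr * expr)
}.

Fixpoint all_of (A : Type) (P : A -> Prop) (l : seq A) : Prop :=
  if l is a :: l' then P a /\ all_of P l' else True.

Fixpoint some_of (A : Type) (P : A -> Prop) (l : seq A) : Prop :=
  if l is a :: l' then P a \/ some_of P l' else False.

Lemma all_of_impl (A : Type) (P Q : A -> Prop) l :
  (forall a, P a -> Q a) -> all_of P l -> all_of Q l.
Proof. by move=> PQ; elim: l => //= a l IH [/PQ ? /IH]. Qed.

Lemma some_of_impl (A : Type) (P Q : A -> Prop) l :
  (forall a, P a -> Q a) -> some_of P l -> some_of Q l.
Proof. by move=> PQ; elim: l => //= a l IH [Pa|/IH Pl]; [left; apply: PQ|right]. Qed.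

Definition fires (P : nat -> Prop) (cl : clause) (e : nat) (w : nat -> nat) : Prop :=
  [/\ e = eval (conc cl) w,
      all_of (fun p => P (eval p w)) (prems cl)
    & all_of (fun ab => eval ab.1 w <> eval ab.2 w) (neqs cl)].

(** Slots 0 to 3 of an environment hold the search bound, the input, the table
    and the current table entry; clauses use the slots below. *)
Definition clause_vars : seq nat := iota 4 9.

Variable rules : seq clause.

Fixpoint in_clause_vars (e : expr) : bool :=
  match e with
  | Var i => i \in clause_vars
  | Cst _ => true
  | App _ a b => in_clause_vars a && in_clause_vars b
  | Sum _ _ _ => false
  end.

Lemma eval_in_clause_vars e u w : {in clause_vars, u =1 w} -> in_clause_vars e ->
  eval e u = eval e w.
Proof.
by move=> uw; elim: e => //= o a IHa b IHb /andP[/IHa-> /IHb->].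
Qed.

Definition clause_ok (cl : clause) : bool :=
  [&& in_clause_vars (conc cl), all in_clause_vars (prems cl)
    & all (fun ab => in_clause_vars ab.1 && in_clause_vars ab.2) (neqs cl)].

Lemma fires_ext P cl e u w : clause_ok cl -> {in clause_vars, u =1 w} ->
  fires P cl e w -> fires P cl e u.
Proof.
case: cl => c ps ns /and3P[/= okc okp okn] uw [/= Ec Hp Hn].
have E a := eval_in_clause_vars (e := a) uw.
split=> /=; first by rewrite E.
  by elim: ps okp Hp {Ec okc} => //= p ps IH /andP[okp /IH{}IH] [Pp /IH]; rewrite E.
elim: ns okn Hn {Ec okc} => //= n l IH /andP[/andP[ok1 ok2] /IH{}IH] [Pn /IH].
by rewrite !E.
Qed.

(** The bound [b] on the slots makes justification expressible with bounded quantifiers. *)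
Definition justified (P : nat -> Prop) (b e : nat) : Prop :=
  some_of (fun cl => exists w,
    all_of (fun i => w i < b) clause_vars /\ fires P cl e w) rules.

Lemma justified_mono (P Q : nat -> Prop) b c e :
  (forall x, P x -> Q x) -> b <= c -> justified P b e -> justified Q c e.
Proof.
move=> PQ lebc; apply: some_of_impl => cl [w [wb [E H1 H2]]]; exists w; split.
  by apply: all_of_impl wb => i ltb; apply: leq_trans lebc.
by split=> //; apply: all_of_impl H1 => p; apply: PQ.
Qed.

(** Premises are indexed by position, which keeps the recursive occurrence strictly positive and
    yields an induction hypothesis for each premise. *)
Inductive derivable : nat -> Prop :=
| Derivable i w e : i < size rules ->
    let cl := nth (Clause (Cst 0) [::] [::]) rules i in
    e = eval (conc cl) w ->
    (forall j, j < size (prems cl) -> derivable (eval (nth (Cst 0) (prems cl) j) w)) ->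
    all_of (fun ab => eval ab.1 w <> eval ab.2 w) (neqs cl) ->
    derivable e.

Definition closed_list (b : nat) (l : seq nat) : Prop :=
  forall e, e \in l -> justified (fun x => x \in l) b e.

Lemma closed_list_cat b c l m : closed_list b l -> closed_list c m ->
  closed_list (maxn b c) (l ++ m).
Proof.
move=> cl cm e; rewrite mem_cat => /orP[/cl|/cm]; apply: justified_mono => [x|].
- by rewrite mem_cat => ->.
- exact: leq_maxl.
- by rewrite mem_cat orbC => ->.
- exact: leq_maxr.
Qed.

Lemma some_of_nth (A : Type) (P : A -> Prop) l x0 i :
  i < size l -> P (nth x0 l i) -> some_of P l.
Proof. by elim: l i => //= a l IH [|i]; [left|right; apply: (IH i)]. Qed.

Lemma all_of_mem (P : nat -> Prop) (l : seq nat) :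
  (forall i, i \in l -> P i) -> all_of P l.
Proof.
elim: l => //= a l IH H; split; first by apply: H; rewrite mem_head.
by apply: IH => i il; apply: H; rewrite inE il orbT.
Qed.

(** The tables of the premises are concatenated and [e] is added; closedness survives unions and
    larger bounds. *)
Lemma derivable_table e : derivable e -> exists b l, e \in l /\ closed_list b l.
Proof.
elim=> {e} i w e lti cl Ee _ IH neq.
have [b [l [sub_l cl_l]]] : exists b l,
    all_of (fun p => eval p w \in l) (prems cl) /\ closed_list b l.
  elim: (prems cl) IH => [|p ps IHps] IH; first by exists 0, [::].
  have [b [l [pl cll]]] := IH 0 isT.
  have [c [m [psm clm]]] := IHps (fun j => IH j.+1).
  exists (maxn b c), (l ++ m); split; last exact: closed_list_cat.
  split; first by rewrite mem_cat pl.
  by apply: all_of_impl psm => q; rewrite mem_cat orbC => ->.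
(* The new bound also exceeds every slot value used by the last clause. *)
pose c := maxn b (\max_(i <- clause_vars) w i).+1.
exists c, (e :: l); split; first exact: mem_head.
have sub x : x \in l -> x \in e :: l by rewrite inE orbC => ->.
move=> e'; rewrite inE => /predU1P[->|/cl_l]; last first.
  by apply: justified_mono => //; apply: leq_maxl.
apply: (some_of_nth (x0 := Clause (Cst 0) [::] [::]) (i := i)) => //.
exists w; split.
  apply: all_of_mem => j jv; rewrite /c leq_max ltnS.
  by rewrite (leq_bigmax_seq j jv) // orbT.
by split=> //; apply: all_of_impl sub_l => p; apply: sub.
Qed.

Definition FTrue : fm := FEq (Cst 0) (Cst 0).

Definition clause_fm (cl : clause) : fm :=
  FAnd (FEq (Var 3) (conc cl))
    (FAnd (foldr FAnd FTrue [seq FBit p (Var 2) | p <- prems cl])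
          (foldr FAnd FTrue [seq FNot (FEq ab.1 ab.2) | ab <- neqs cl])).

Lemma den_conj (A : Type) (f : A -> fm) l v :
  den (foldr FAnd FTrue [seq f a | a <- l]) v <-> all_of (fun a => den (f a) v) l.
Proof. by elim: l => //= a l ->. Qed.

Lemma den_disj (A : Type) (f : A -> fm) l v :
  den (foldr FOr (FNot FTrue) [seq f a | a <- l]) v <-> some_of (fun a => den (f a) v) l.
Proof. by elim: l => [|a l IH] /=; [split=> // /(_ erefl)|rewrite IH]. Qed.

Lemma den_clause cl w :
  den (clause_fm cl) w <-> fires (fun x => bit x (w 2)) cl (w 3) w.
Proof.
by rewrite /= !den_conj; split=> [[E [H1 H2]]|[E H1 H2]].
Qed.

Definition exists_below (l : seq nat) (f : fm) : fm := foldr (fun i => FEx i (Var 0)) f l.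

(** Slot 0 holds the common bound and must not be rebound; with distinct slots, the nested
    quantifiers amount to one choice of [w]. *)
Lemma den_exists_below l f v : uniq l -> 0 \notin l ->
  den (exists_below l f) v <->
  exists w, [/\ forall i, i \notin l -> w i = v i,
               all_of (fun i => w i < v 0) l & den f w].
Proof.
elim: l v => [|i l IH] v /=.
  move=> _ _; split=> [fv|[w [wv _]]]; first by exists v.
  by have -> : w = v by apply: functional_extensionality => i; apply: wv.
move=> /andP[il ul]; rewrite inE negb_or => /andP[i0 l0]; split.
  case=> x [ltx /IH[] // w [wv wl fw]]; exists w.
  have E0 : update v i x 0 = v 0 by case: (i) i0.
  rewrite E0 in wl; split=> //.
    move=> j; rewrite inE negb_or => /andP[ji jl]; rewrite wv // /update.
    by case: PeanoNat.Nat.eqb_spec => // E; rewrite E eqxx in ji.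
  by rewrite wv // /update PeanoNat.Nat.eqb_refl.
case=> w [wv [wi wl] fw]; exists (w i); split=> //; apply/IH => //; exists w.
have E0 : update v i (w i) 0 = v 0 by case: (i) i0.
rewrite E0; split=> // j jl; rewrite /update; case: PeanoNat.Nat.eqb_spec => [->|/eqP ji] //.
by rewrite wv // inE negb_or ji.
Qed.

Definition justified_fm : fm :=
  foldr FOr (FNot FTrue) [seq exists_below clause_vars (clause_fm cl) | cl <- rules].

Lemma den_exists_clause cl v : clause_ok cl ->
  den (exists_below clause_vars (clause_fm cl)) v <->
  exists w, all_of (fun i => w i < v 0) clause_vars /\
            fires (fun x => bit x (v 2)) cl (v 3) w.
Proof.
move=> okcl; rewrite den_exists_below //.
split=> [[w [wv wl /den_clause]]|[w [wl fcl]]].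
  by rewrite !wv // => fcl; exists w.
(* The given [w] is arbitrary outside the clause slots. There the values of [v] are restored, so
   that slots 2 and 3 hold the table and the entry; the clause reads only its own slots. *)
exists (fun i => if i \in clause_vars then w i else v i).
split=> //; first by move=> i /negbTE->.
by apply/den_clause; apply: fires_ext fcl => // i /= ->.
Qed.

Lemma den_justified v : all clause_ok rules ->
  den justified_fm v <-> justified (fun x => bit x (v 2)) (v 0) (v 3).
Proof.
rewrite den_disj /justified; elim: rules => // cl l IH /andP[okcl /IH{}IH].
have E := den_exists_clause v okcl.
by split=> -[/E|/IH]; [left|right|left|right].
Qed.

End Clauses.

(** * Horn clauses for the translation *)

Local Notation "<< x ; .. ; y ; z >>" := (EPair x .. (EPair y z) ..)
  (at level 0, x at level 99, y at level 99, z at level 99).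

Local Coercion Cst : nat >-> expr.

Definition eSBot := << 2; 0 >>.
Definition eSLab w := << 1; w >>.
Definition eSNeg s := << 3; s >>.
Definition eSOr s t := << 4; s; t >>.
Definition eSBoxE a s := << 5; a; s >>.
Definition eSBoxU s := << 6; s >>.
Definition eSAnd s t := eSNeg (eSOr (eSNeg s) (eSNeg t)).

(** The three guarded modifiers share the outer tag 3, so that a single clause treats the universal
    box under all of them. *)
Definition eMNode := << 1; 0 >>.
Definition eMRoot := << 2; 0 >>.
Definition eMAssign w p := << 3; 1; w; p >>.
Definition eMAdd a p q := << 3; 2; a; p; q >>.
Definition eMDel a p q := << 3; 3; a; p; q >>.

(** Table entries: [(0, (phi, (s, f)))] for [static phi = s] with flag [f],
    [(1, (alpha, (s, (r, f))))] for [box alpha s = r] with flag [f], and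
    [(2, (d, (s, r)))] for [reduce s d = r]. *)
Definition eStatic x s f := << 0; x; s; f >>.
Definition eBox x s r f := << 1; x; s; r; f >>.
Definition eReduce d s r := << 2; d; s; r >>.

(** A test for equal labels in [reduce] becomes two clauses, one with a repeated variable and one
    with a disequation. *)
Definition reduce_rules : seq clause :=
  let a := Var 4 in let b := Var 5 in let d := Var 4 in let z := Var 4 in
  let p := Var 6 in let q := Var 7 in let s := Var 8 in let t := Var 9 in
  let r := Var 10 in let u := Var 11 in
  let fact c := Clause c [::] [::] in
  [:: fact (eReduce d eSBot eSBot);
      Clause (eReduce d (eSNeg s) (eSNeg r)) [:: eReduce d s r] [::];
      Clause (eReduce d (eSOr s t) (eSOr r u)) [:: eReduce d s r; eReduce d t u] [::];
      fact (eReduce eMNode (eSLab b) (eSLab b));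
      fact (eReduce eMRoot (eSLab b) eSBot);
      fact (eReduce (eMAssign b p) (eSLab b) p);
      Clause (eReduce (eMAssign a p) (eSLab b) (eSLab b)) [::] [:: (a, b)];
      fact (eReduce (eMAdd a p q) (eSLab b) (eSLab b));
      fact (eReduce (eMDel a p q) (eSLab b) (eSLab b));
      Clause (eReduce eMNode (eSBoxU s) (eSAnd (eSBoxU r) u))
        [:: eReduce eMNode s r; eReduce eMRoot s u] [::];
      Clause (eReduce eMRoot (eSBoxU s) (eSAnd (eSBoxU r) u))
        [:: eReduce eMNode s r; eReduce eMRoot s u] [::];
      Clause (eReduce << 3; z >> (eSBoxU s) (eSBoxU r))
        [:: eReduce << 3; z >> s r] [::];
      Clause (eReduce eMNode (eSBoxE b s) (eSBoxE b r)) [:: eReduce eMNode s r] [::];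
      fact (eReduce eMRoot (eSBoxE b s) (eSNeg eSBot));
      Clause (eReduce (eMAssign a p) (eSBoxE b s) (eSBoxE b r))
        [:: eReduce (eMAssign a p) s r] [::];
      Clause (eReduce (eMAdd b p q) (eSBoxE b s)
                (eSAnd (eSBoxE b r) (eSOr (eSNeg p) (eSBoxU (eSOr (eSNeg q) r)))))
        [:: eReduce (eMAdd b p q) s r] [::];
      Clause (eReduce (eMAdd a p q) (eSBoxE b s) (eSBoxE b r))
        [:: eReduce (eMAdd a p q) s r] [:: (a, b)];
      Clause (eReduce (eMDel b p q) (eSBoxE b s)
                (eSOr (eSBoxE b r) (eSAnd p (eSBoxE b (eSOr q r)))))
        [:: eReduce (eMDel b p q) s r] [::];
      Clause (eReduce (eMDel a p q) (eSBoxE b s) (eSBoxE b r))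
        [:: eReduce (eMDel a p q) s r] [:: (a, b)]].

Definition box_rules : seq clause :=
  let a := Var 4 in let f := Var 4 in let g := Var 5 in
  let p := Var 6 in let q := Var 7 in let s := Var 8 in
  let r := Var 9 in let u := Var 10 in let x := Var 11 in let y := Var 12 in
  let fact c := Clause c [::] [::] in
  [:: fact (eBox << 1; a >> s (eSBoxE a s) 0);
      fact (eBox << 2; 0 >> s (eSBoxU s) 0);
      Clause (eBox << 3; 0 >> s r 0) [:: eReduce eMNode s r] [::];
      Clause (eBox << 4; 0 >> s r 0) [:: eReduce eMRoot s r] [::];
      Clause (eBox << 5; x >> s (eSOr (eSNeg p) s) f) [:: eStatic x p f] [::];
      Clause (eBox << 6; a; x >> s r g)
        [:: eStatic x p g; eReduce (eMAssign a p) s r] [::];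
      fact (eBox << 7; x >> s s 1);
      Clause (eBox << 8; a; x; y >> s r (EAdd g u))
        [:: eStatic x p g; eStatic y q u; eReduce (eMAdd a p q) s r] [::];
      Clause (eBox << 9; a; x; y >> s r (EAdd g u))
        [:: eStatic x p g; eStatic y q u; eReduce (eMDel a p q) s r] [::];
      Clause (eBox << 10; x; y >> s r (EAdd f g))
        [:: eBox y s u g; eBox x u r f] [::];
      Clause (eBox << 11; x; y >> s (eSAnd r u) (EAdd f g))
        [:: eBox x s r f; eBox y s u g] [::];
      fact (eBox << 12; x >> s s 1)].

Definition static_rules : seq clause :=
  let w := Var 4 in let f := Var 5 in let g := Var 6 in
  let p := Var 7 in let q := Var 8 in let x := Var 9 in let y := Var 10 in
  let fact c := Clause c [::] [::] in
  [:: fact (eStatic << 1; w >> (eSLab w) 0);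
      fact (eStatic << 2; 0 >> eSBot 0);
      Clause (eStatic << 3; x >> (eSNeg p) f) [:: eStatic x p f] [::];
      Clause (eStatic << 4; x; y >> (eSOr p q) (EAdd f g))
        [:: eStatic x p f; eStatic y q g] [::];
      Clause (eStatic << 5; x; y >> q (EAdd f g))
        [:: eStatic y p f; eBox x p q g] [::]].

Definition rules : seq clause := reduce_rules ++ box_rules ++ static_rules.

Lemma rules_ok : all clause_ok rules.
Proof. by []. Qed.

Arguments Cantor.to_nat : simpl never.

Section Graph.

Variables F Omega : countType.
Notation sform := (sform F Omega).
Notation modifier := (modifier F Omega).

Definition mcode (d : modifier) : nat :=
  match d with
  | MNode => pr 1 0
  | MRoot => pr 2 0
  | MAssign w p => pr 3 (pr 1 (pr (pickle w) (scode p)))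
  | MAdd a p q => pr 3 (pr 2 (pr (pickle a) (pr (scode p) (scode q))))
  | MDel a p q => pr 3 (pr 3 (pr (pickle a) (pr (scode p) (scode q))))
  end.

Definition tstatic x s f := pr 0 (pr x (pr s f)).
Definition tbox x s r f := pr 1 (pr x (pr s (pr r f))).
Definition treduce d s r := pr 2 (pr d (pr s r)).

(** * Soundness of closed tables *)

Section Soundness.

Variables (P : nat -> Prop) (b : nat).
Hypothesis closedP : forall e, P e -> justified rules P b e.

Lemma some_of_cat (A : Type) (Q : A -> Prop) l m :
  some_of Q (l ++ m) <-> some_of Q l \/ some_of Q m.
Proof. by elim: l => /= [|a l ->]; tauto. Qed.

Lemma justified_fires e : P e ->
  some_of (fun cl => exists w, fires P cl e w) reduce_rules \/
  some_of (fun cl => exists w, fires P cl e w) box_rules \/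
  some_of (fun cl => exists w, fires P cl e w) static_rules.
Proof.
move=> /closedP; rewrite /justified !some_of_cat.
by case=> [|[]] H; [left|right; left|right; right]; apply: some_of_impl H => cl [w [_ ?]]; exists w.
Qed.

Ltac pr_inv :=
  repeat match goal with
  | H : pr _ _ = pr _ _ |- _ => apply pr_inj in H; destruct H; try discriminate
  | H : pickle _ = pickle _ |- _ => apply pickle_inj in H
  end; try discriminate.

(** Finds the clauses that can conclude a fact: slot values are generalised to variables so that
    inverting pairs can eliminate them, and clashing tags discard the other clauses. *)
Ltac rule_cases H :=
  simpl in H;
  repeat match type of H with
         | _ \/ _ => destruct H as [H|H]
         | False => destruct H
         end;
  let w := fresh "w" in let E := fresh "E" in
  let prem := fresh "prem" in let neq := fresh "neq" in
  destruct H as [w [E prem neq]]; simpl in E, prem, neq;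
  revert E prem neq;
  generalize (w 4) (w 5) (w 6) (w 7) (w 8) (w 9) (w 10) (w 11) (w 12);
  clear w; intros; pr_inv; subst.

Lemma inv_reduce e : P (pr 2 e) -> some_of (fun cl => exists w, fires P cl (pr 2 e) w) reduce_rules.
Proof. by move=> /justified_fires[//|[]] H; exfalso; rule_cases H. Qed.

Lemma inv_box e : P (pr 1 e) -> some_of (fun cl => exists w, fires P cl (pr 1 e) w) box_rules.
Proof. by move=> /justified_fires[|[//|]] H; exfalso; rule_cases H. Qed.

Lemma inv_static e : P (pr 0 e) -> some_of (fun cl => exists w, fires P cl (pr 0 e) w) static_rules.
Proof. by move=> /justified_fires[|[|//]] H; exfalso; rule_cases H. Qed.

(** The induction is on [s], since a circular table offers no derivation to induct on: premises
    always concern constituents of [s]. [d] stays general because [MNode] and [MRoot] refer to each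
    other. *)
Lemma reduce_sound (s : sform) d r : P (treduce (mcode d) (scode s) r) -> r = scode (reduce s d).
Proof.
elim: s d r => [w||s IH|s IHs t IHt|a s IH|s IH] d r /inv_reduce H; rule_cases H.
all: repeat match goal with H : _ /\ _ |- _ => destruct H end.
(* Inversion spells out the code of [d]; folding it back to [mcode d] makes the induction hypotheses
   match. *)
all: repeat match goal with
  | H : mcode ?d = ?X, Hp : context [?X] |- _ => rewrite -H in Hp
  end.
all: repeat match goal with
  | IH : forall d r, P (treduce (mcode d) (scode ?s) r) -> _ |- _ =>
    match goal with
    | Hp : P (pr 2 (pr (mcode ?d) (pr (scode s) _))) |- _ => apply (IH d) in Hp
    | Hp : P (pr 2 (pr (pr 1 0) (pr (scode s) _))) |- _ => apply (IH (MNode F Omega)) in Hp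
    | Hp : P (pr 2 (pr (pr 2 0) (pr (scode s) _))) |- _ => apply (IH (MRoot F Omega)) in Hp
    end
  end; subst; rewrite //.
all: destruct d; try discriminate; simpl in *; pr_inv; subst; rewrite ?eqxx //.
all: try (by case: eqP => // E; subst).
Qed.

(** In the sequence case the fact about the second action has to be used first: only then is the
    postcondition of the first action known to be a [scode]. *)
Lemma translation_sound :
  (forall (alpha : action F Omega) (s : sform) r f,
     P (tbox (action_code alpha) (scode s) r f) ->
     r = scode (box alpha s) /\ f = flagA alpha) /\
  (forall (phi : formula F Omega) p f, P (tstatic (formula_code phi) p f) ->
     p = scode (static phi) /\ f = flagF phi).
Proof.
apply: action_formula_ind.
(* Each constructor has its own tag, so one clause survives in each case and the goals keep their
   numbers. *)
1-12: intros; match goal with Hp : P (tbox _ _ _ _) |- _ =>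
    rewrite /tbox /= ?to_natE in Hp; apply inv_box in Hp; rule_cases Hp end.
13-17: intros; match goal with Hp : P (tstatic _ _ _) |- _ =>
    rewrite /tstatic /= ?to_natE in Hp; apply inv_static in Hp; rule_cases Hp end.
all: repeat match goal with H : _ /\ _ |- _ => destruct H end.
all: repeat match goal with
  | IH : forall p f, P (tstatic (formula_code ?phi) p f) -> _,
    Hp : P (pr 0 (pr (formula_code ?phi) _)) |- _ => apply IH in Hp; destruct Hp; subst
  | IH : forall s r f, P (tbox (action_code ?a) (scode s) r f) -> _,
    Hp : P (pr 1 (pr (action_code ?a) (pr (scode _) _))) |- _ =>
      apply IH in Hp; destruct Hp; subst
  end; try by [].
- by split=> //; apply: (@reduce_sound _ (MNode F Omega)).
- by split=> //; apply: (@reduce_sound _ (MRoot F Omega)).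
- by split=> //; apply: (@reduce_sound _ (MAssign w (static phi))).
- by split=> //; apply: (@reduce_sound _ (MAdd a (static phi) (static psi))).
- by split=> //; apply: (@reduce_sound _ (MDel a (static phi) (static psi))).
Qed.

End Soundness.

(** * Derivability of the translation *)

Definition slots (l : seq nat) : nat -> nat := fun i => nth 0 l (i - 4).

Notation der := (derivable rules).

(** [i] is the position of the clause in [rules], and [l] lists the values of
    the slots from 4 on. *)
Lemma der_rule i (l : seq nat) : i < size rules ->
  let cl := nth (Clause (Cst 0) [::] [::]) rules i in
  all_of (fun p => der (eval p (slots l))) (prems cl) ->
  all_of (fun ab => eval ab.1 (slots l) <> eval ab.2 (slots l)) (neqs cl) ->
  der (eval (conc cl) (slots l)).
Proof.
move=> lti cl; move=> Hp Hn; apply: (Derivable lti erefl _ Hn) => j.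
rewrite -/cl; elim: (prems cl) j Hp => //= p ps IH [|j] [? ?] //; exact: IH.
Qed.

(** Follows [reduce] case by case; each case names its rule and the slot values, with 0 as a filler
    for slots that the rule does not read. *)
Lemma der_reduce (s : sform) d : der (treduce (mcode d) (scode s) (scode (reduce s d))).
Proof.
have neq (T : countType) (x y : T) : x <> y -> pickle x <> pickle y.
  by move=> ne /pickle_inj.
elim: s d => [w||s IH|s IHs t IHt|a s IH|s IH] d.
- case: d => [||w' p|b p q|b p q].
  + exact: (@der_rule 3 [:: 0; pickle w] isT I I).
  + exact: (@der_rule 4 [:: 0; pickle w] isT I I).
  + rewrite /=; case: eqP => [->|/neq ne].
      exact: (@der_rule 5 [:: 0; pickle w; scode p] isT I I).
    exact: (@der_rule 6 [:: pickle w'; pickle w; scode p] isT I (conj ne I)).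
  + exact: (@der_rule 7 [:: pickle b; pickle w; scode p; scode q] isT I I).
  + exact: (@der_rule 8 [:: pickle b; pickle w; scode p; scode q] isT I I).
- exact: (@der_rule 0 [:: mcode d] isT I I).
- exact: (@der_rule 1 [:: mcode d; 0; 0; 0; scode s; 0; scode (reduce s d)] isT (conj (IH d) I) I).
- exact: (@der_rule 2 [:: mcode d; 0; 0; 0; scode s; scode t; scode (reduce s d); scode (reduce t d)] isT (conj (IHs d) (conj (IHt d) I)) I).
- case: d => [||w p|b p q|b p q].
  + exact: (@der_rule 12 [:: 0; pickle a; 0; 0; scode s; 0; scode (reduce s (MNode F Omega))] isT (conj (IH (MNode F Omega)) I) I).
  + exact: (@der_rule 13 [:: 0; pickle a; 0; 0; scode s] isT I I).
  + exact: (@der_rule 14 [:: pickle w; pickle a; scode p; 0; scode s; 0; scode (reduce s (MAssign w p))] isT (conj (IH (MAssign w p)) I) I).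
  + rewrite [reduce _ _]/=; case: eqP => [->|/neq ne].
      exact: (@der_rule 15 [:: 0; pickle a; scode p; scode q; scode s; 0; scode (reduce s (MAdd a p q))] isT (conj (IH (MAdd a p q)) I) I).
    exact: (@der_rule 16 [:: pickle b; pickle a; scode p; scode q; scode s; 0; scode (reduce s (MAdd b p q))] isT (conj (IH (MAdd b p q)) I) (conj ne I)).
  + rewrite [reduce _ _]/=; case: eqP => [->|/neq ne].
      exact: (@der_rule 17 [:: 0; pickle a; scode p; scode q; scode s; 0; scode (reduce s (MDel a p q))] isT (conj (IH (MDel a p q)) I) I).
    exact: (@der_rule 18 [:: pickle b; pickle a; scode p; scode q; scode s; 0; scode (reduce s (MDel b p q))] isT (conj (IH (MDel b p q)) I) (conj ne I)).
- case: d => [||w p|b p q|b p q].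
  + exact: (@der_rule 9 [:: 0; 0; 0; 0; scode s; 0; scode (reduce s (MNode F Omega)); scode (reduce s (MRoot F Omega))] isT (conj (IH (MNode F Omega)) (conj (IH (MRoot F Omega)) I)) I).
  + exact: (@der_rule 10 [:: 0; 0; 0; 0; scode s; 0; scode (reduce s (MNode F Omega)); scode (reduce s (MRoot F Omega))] isT (conj (IH (MNode F Omega)) (conj (IH (MRoot F Omega)) I)) I).
  (* Slot 4 receives the code of the modifier without its outer tag 3. *)
  + exact: (@der_rule 11 [:: pr 1 (pr (pickle w) (scode p)); 0; 0; 0; scode s; 0; scode (reduce s (MAssign w p))] isT (conj (IH (MAssign w p)) I) I).
  + exact: (@der_rule 11 [:: pr 2 (pr (pickle b) (pr (scode p) (scode q))); 0; 0; 0; scode s; 0; scode (reduce s (MAdd b p q))] isT (conj (IH (MAdd b p q)) I) I).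
  + exact: (@der_rule 11 [:: pr 3 (pr (pickle b) (pr (scode p) (scode q))); 0; 0; 0; scode s; 0; scode (reduce s (MDel b p q))] isT (conj (IH (MDel b p q)) I) I).
Qed.

Lemma der_translation :
  (forall (alpha : action F Omega) (s : sform),
     der (tbox (action_code alpha) (scode s) (scode (box alpha s)) (flagA alpha))) /\
  (forall phi : formula F Omega,
     der (tstatic (formula_code phi) (scode (static phi)) (flagF phi))).
Proof.
apply: action_formula_ind => [a||||phi IH|w phi IH|w phi IH|a phi IHp psi IHq|a phi IHp psi IHq|
  al IHa be IHb|al IHa be IHb|al IH|w||phi IH|phi IHp psi IHq|al IHa phi IH];
  rewrite /tbox /tstatic.
- move=> s; rewrite [action_code _]/= ?to_natE.
  exact: (@der_rule 19 [:: pickle a; 0; 0; 0; scode s] isT I I).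
- move=> s; rewrite [action_code _]/= ?to_natE.
  exact: (@der_rule 20 [:: 0; 0; 0; 0; scode s] isT I I).
- move=> s; rewrite [action_code _]/= ?to_natE.
  exact: (@der_rule 21 [:: 0; 0; 0; 0; scode s; scode (reduce s (MNode F Omega))] isT (conj (der_reduce s (MNode F Omega)) I) I).
- move=> s; rewrite [action_code _]/= ?to_natE.
  exact: (@der_rule 22 [:: 0; 0; 0; 0; scode s; scode (reduce s (MRoot F Omega))] isT (conj (der_reduce s (MRoot F Omega)) I) I).
- move=> s; rewrite [action_code _]/= ?to_natE.
  exact: (@der_rule 23 [:: flagF phi; 0; scode (static phi); 0; scode s; 0; 0; formula_code phi] isT (conj IH I) I).
- move=> s; rewrite [action_code _]/= ?to_natE.
  exact: (@der_rule 24 [:: pickle w; flagF phi; scode (static phi); 0; scode s; scode (box (GlobalAssign w phi) s); 0; formula_code phi] isT (conj IH (conj (der_reduce s (MAssign w (static phi))) I)) I).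
- move=> s; rewrite [action_code _]/= ?to_natE.
  exact: (@der_rule 25 [:: 0; 0; 0; 0; scode s; 0; 0; pr (pickle w) (formula_code phi)] isT I I).
- move=> s; rewrite [action_code _]/= ?to_natE.
  exact: (@der_rule 26 [:: pickle a; flagF phi; scode (static phi); scode (static psi); scode s; scode (box (AddEdges a phi psi) s); flagF psi; formula_code phi; formula_code psi] isT (conj IHp (conj IHq (conj (der_reduce s (MAdd a (static phi) (static psi))) I))) I).
- move=> s; rewrite [action_code _]/= ?to_natE.
  exact: (@der_rule 27 [:: pickle a; flagF phi; scode (static phi); scode (static psi); scode s; scode (box (DelEdges a phi psi) s); flagF psi; formula_code phi; formula_code psi] isT (conj IHp (conj IHq (conj (der_reduce s (MDel a (static phi) (static psi))) I))) I).
- move=> s; rewrite [action_code _]/= ?to_natE.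
  exact: (@der_rule 28 [:: flagA al; flagA be; 0; 0; scode s; scode (box (Seq al be) s); scode (box be s); action_code al; action_code be] isT (conj (IHb s) (conj (IHa (box be s)) I)) I).
- move=> s; rewrite [action_code _]/= ?to_natE.
  exact: (@der_rule 29 [:: flagA al; flagA be; 0; 0; scode s; scode (box al s); scode (box be s); action_code al; action_code be] isT (conj (IHa s) (conj (IHb s) I)) I).
- move=> s; rewrite [action_code _]/= ?to_natE.
  exact: (@der_rule 30 [:: 0; 0; 0; 0; scode s; 0; 0; action_code al] isT I I).
- rewrite [formula_code _]/= ?to_natE.
  exact: (@der_rule 31 [:: pickle w] isT I I).
- rewrite [formula_code _]/= ?to_natE.
  exact: (@der_rule 32 [::] isT I I).
- rewrite [formula_code _]/= ?to_natE.
  exact: (@der_rule 33 [:: 0; flagF phi; 0; scode (static phi); 0; formula_code phi] isT (conj IH I) I).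
- rewrite [formula_code _]/= ?to_natE.
  exact: (@der_rule 34 [:: 0; flagF phi; flagF psi; scode (static phi); scode (static psi); formula_code phi; formula_code psi] isT (conj IHp (conj IHq I)) I).
- rewrite [formula_code _]/= ?to_natE.
  exact: (@der_rule 35 [:: 0; flagF phi; flagA al; scode (static phi); scode (static (Box al phi)); action_code al; formula_code phi] isT (conj IH (conj (IHa (static phi)) I)) I).
Qed.

End Graph.

(** * The decision procedure *)

(** Kept in the exact shape of [coherent], so that the denotation is convertible to it. *)
Definition coherent_fm (n S H : expr) : fm :=
  let t := Var 7 in let u := Var 8 in
  let p := Var 9 in let q := Var 10 in let a := Var 11 in
  let types f := FAll 7 H (FImp (FBit t H) f) in
  FAnd (types (FNot (FBit eSBot t)))
    (FAll 9 n (FAnd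
      (FImp (FBit (eSNeg p) S)
         (FAnd (FBit p S) (types (FIff (FBit (eSNeg p) t) (FNot (FBit p t))))))
    (FAnd
      (FAll 10 n (FImp (FBit (eSOr p q) S)
         (FAnd (FBit p S) (FAnd (FBit q S)
            (types (FIff (FBit (eSOr p q) t) (FOr (FBit p t) (FBit q t))))))))
    (FAnd
      (FImp (FBit (eSBoxU p) S)
         (FAnd (FBit p S)
            (types (FIff (FBit (eSBoxU p) t)
                      (FAll 8 H (FImp (FBit u H) (FBit p u)))))))
      (FAll 11 n (FImp (FBit (eSBoxE a p) S)
         (FAnd (FBit p S)
            (types (FImp (FNot (FBit (eSBoxE a p) t))
               (FEx 8 H (FAnd (FBit u H) (FAnd (FNot (FBit p u))
                  (FAll 10 n (FImp (FBit (eSBoxE a q) t) (FBit q u))))))))))))))).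

Definition type_valid_fm : fm :=
  let y := Var 4 in let S := Var 5 in let H := Var 6 in let t := Var 7 in
  let n := EAdd (Var 4) (Cst 1) in
  FAll 5 (EPow n) (FAll 6 (EPow (EPow n))
    (FImp (FBit y S) (FImp (coherent_fm n S H)
       (FAll 7 H (FImp (FBit t H) (FBit y t)))))).

Definition closed_table_fm : fm :=
  FAll 3 (Var 0) (FImp (FBit (Var 3) (Var 2)) (justified_fm rules)).

Definition closed_table (z T : nat) : Prop :=
  forall e, e < z -> bit e T -> justified rules (fun x => bit x T) z e.

Lemma den_closed_table v : den closed_table_fm v <-> closed_table (v 0) (v 2).
Proof.
have E e := den_justified (update v 3 e) rules_ok.
by split=> H e lt eT; [exact: (proj1 (E e) (H e lt eT)) | exact: (proj2 (E e) (H e lt eT))].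
Qed.

Definition found_fm : fm :=
  FEx 2 (Var 0) (FAnd closed_table_fm
    (FEx 4 (Var 0) (FEx 5 (Var 0)
       (FBit (eStatic (Var 1) (Var 4) (Var 5)) (Var 2))))).

(** The flag has to be 0, so a formula outside the fragment gets a negative answer. *)
Definition answer_fm : fm :=
  FEx 2 (Var 0) (FAnd closed_table_fm
    (FEx 4 (Var 0) (FAnd
       (FBit (eStatic (Var 1) (Var 4) (Cst 0)) (Var 2)) type_valid_fm))).

Lemma den_found z x :
  den found_fm (env2 z x) <->
  exists T, T < z /\ (closed_table z T /\
    exists y, y < z /\ exists f, f < z /\ bit (tstatic x y f) T).
Proof.
have E T := den_closed_table (update (env2 z x) 2 T).
split=> -[T [ltT [H1 H2]]]; exists T; split=> //; split=> //.
  exact: (proj1 (E T) H1).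
exact: (proj2 (E T) H1).
Qed.

Lemma den_answer z x :
  den answer_fm (env2 z x) <->
  exists T, T < z /\ (closed_table z T /\
    exists y, y < z /\ (bit (tstatic x y 0) T /\ type_valid (y + 1) y)).
Proof.
have E T := den_closed_table (update (env2 z x) 2 T).
split=> -[T [ltT [H1 H2]]]; exists T; split=> //; split=> //.
  exact: (proj1 (E T) H1).
exact: (proj2 (E T) H1).
Qed.

(** Negated because unbounded minimisation looks for a zero. *)
Definition op_not_found : binop := @binop_of (ENot (fm_expr found_fm)) isT.
Definition op_answer : binop :=
  @binop_of (ENot (ENot (fm_expr answer_fm))) isT.

Lemma op_not_foundE z x : op_not_found z x = 0 <-> den found_fm (env2 z x).
Proof.
rewrite -fm_exprP -[op_not_found z x]/(1 - eval (fm_expr found_fm) (env2 z x)).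
by case: (eval _ _) => [|n]; split.
Qed.

Lemma op_answer1 z x : den answer_fm (env2 z x) -> op_answer z x = 1.
Proof.
rewrite -fm_exprP -[op_answer z x]/(1 - (1 - eval (fm_expr answer_fm) (env2 z x))).
by case: (eval _ _).
Qed.

Lemma op_answer0 z x : ~ den answer_fm (env2 z x) -> op_answer z x = 0.
Proof.
rewrite -fm_exprP -[op_answer z x]/(1 - (1 - eval (fm_expr answer_fm) (env2 z x))).
by case: (eval _ _) => // n [].
Qed.

Section Decision.

Variables F Omega : countType.
Implicit Type phi : formula F Omega.

Lemma found_exists phi : exists z, den found_fm (env2 z (formula_code phi)).
Proof.
have [b [l [el cl]]] := derivable_table (proj2 (@der_translation F Omega) phi).
set e := tstatic _ _ _ in el.
have [T _ TP] := set_exists (\max_(x <- l) x).+1 (fun x => x \in l).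
have {}TP x : bit x T <-> x \in l.
  by rewrite TP; split=> [[]|xl] //; split=> //; rewrite ltnS (leq_bigmax_seq x).
(* One bound for the slot values, the code of the table, the translation and the flag. *)
exists (maxn b (maxn T.+1 (maxn (scode (static phi)).+1 (flagF phi).+1))).
apply/den_found; exists T; split; first by lia.
split=> [x _ /TP /cl|].
  by apply: justified_mono => [y|]; [rewrite TP | lia].
exists (scode (static phi)); split; first by lia.
exists (flagF phi); split; first by lia.
by apply/TP.
Qed.

(** Every entry is less than [T], hence less than [z], so closedness below [z] covers the whole
    table. *)
Lemma closed_table_sound z T phi y f : T < z -> closed_table z T ->
  bit (tstatic (formula_code phi) y f) T -> y = scode (static phi) /\ f = flagF phi.
Proof.
move=> ltT cT; apply: (proj2 (@translation_sound F Omega (fun x => bit x T) z _)).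
by move=> e eT; apply: cT => //; apply: ltn_trans ltT; apply: bit_lt.
Qed.

(** By soundness every closed table with a fact about [phi] yields the same translation and flag, so
    the answer does not depend on the table found. *)
Lemma den_answerP z phi : den found_fm (env2 z (formula_code phi)) ->
  den answer_fm (env2 z (formula_code phi)) <->
  [/\ ~~ formula_occurs (@is_local_assign F Omega) phi,
      ~~ formula_occurs (@is_star F Omega) phi
    & valid_in (@all_termgraphs F Omega) phi].
Proof.
move=> /den_found[T [ltT [cT [y [lty [f [ltf yT]]]]]]]; rewrite den_answer.
have [Ey Ef] := closed_table_sound ltT cT yT; rewrite {}Ey {}Ef in lty ltf yT.
have flagP := proj2 (@flag_eq0 F Omega) phi.
have valid_static : flagF phi = 0 ->
    type_valid (scode (static phi) + 1) (scode (static phi)) <->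
    valid_in (@all_termgraphs F Omega) phi.
  move=> /(proj2 (@sat_static F Omega)) E; rewrite addn1 type_validP.
  by split=> [H G _|H G]; apply/E; apply: H.
split=> [[T' [ltT' [cT' [y' [_ [yT']]]]]]|[noL noS valid]].
  have [-> f0] := closed_table_sound ltT' cT' yT'.
  move: flagP; rewrite -f0 eqxx => /esym/andP[noL noS] valid.
  by split=> //; apply/valid_static.
move: flagP; rewrite noL noS => /eqP f0.
exists T; split=> //; split=> //; exists (scode (static phi)); split=> //.
by rewrite f0 in yT; split=> //; apply/valid_static.
Qed.

End Decision.

Theorem mainTheorem3 (F Omega : countType) :
  decidable_set (@formula_code F Omega)
    (fun phi : formula F Omega =>
       [/\ ~~ formula_occurs (@is_local_assign F Omega) phi,
           ~~ formula_occurs (@is_star F Omega) phi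
         & valid_in (@all_termgraphs F Omega) phi]).
Proof.
(* Minimisation finds the least bound that admits a table for the input; the bounded test is then
   evaluated at that bound. *)
exists (rcomp2 (bcode op_answer) (RMin (bcode op_not_found)) (rproj 1 0)) => phi.
set x := formula_code phi.
have foundP z := op_not_foundE z x.
have [z zP min_z] : exists2 z, den found_fm (env2 z x) &
    forall y, y < z -> op_not_found y x != 0.
  have ex : exists z, op_not_found z x == 0.
    by have [z zP] := found_exists phi; exists z; apply/eqP/foundP.
  case: (ex_minnP ex) => z /eqP/foundP zP min_z; exists z => // y.
  by rewrite ltnNge; apply: contra; apply: min_z.
have evalR b : op_answer z x = b ->
    reval (rcomp2 (bcode op_answer) (RMin (bcode op_not_found)) (rproj 1 0)) [tuple x] b.
  move=> <-; apply: (reval_comp2 (x1 := z) _ (reval_proj 0 _) (bcodeP op_answer _ _)).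
  split=> [|y /min_z nz].
    have := bcodeP op_not_found z x; rewrite (proj2 (foundP z) zP) => found0.
    exact: (reval_val found0).
  (* Before the least bound the value is positive, and [RMin] asks for its predecessor. *)
  exists (op_not_found y x).-1; rewrite prednK ?lt0n //.
  exact: (reval_val (bcodeP op_not_found y x)).
have LP := den_answerP zP.
by split=> [/LP/op_answer1|nL]; apply: evalR => //; apply: op_answer0 => /LP.
Qed.
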